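(* Let $L\in\mathbb{Z}_{>0}$, $\gamma,h,\mu_1,\dots,\mu_L\in\mathbb{C}$, and let $\mathcal{Z}(\lambda_1,\dots,\lambda_L)=\langle\bar 0|\,\mathcal{B}(\lambda_1)\mathcal{B}(\lambda_2)\cdots\mathcal{B}(\lambda_L)\,|0\rangle$ be the partition function of the six-vertex model with one reflecting end and domain-wall boundaries (see context). Then for all $\lambda_0,\lambda_1,\dots,\lambda_L\in\mathbb{C}$ (at which the coefficients below are defined) \[ M_0\,\mathcal{Z}(\lambda_1,\dots,\lambda_L)+\sum_{i=1}^{L} M_i\,\mathcal{Z}(\lambda_0,\lambda_1,\dots,\lambda_{i-1},\lambda_{i+1},\dots,\lambda_L)=0, \] where \[ M_0=\bar\Lambda_{\mathcal{A}}(\lambda_0)-\Lambda_{\mathcal{A}}(\lambda_0)\prod_{j=1}^{L}\frac{a(\lambda_j-\lambda_0)}{b(\lambda_j-\lambda_0)}\frac{b(\lambda_j+\lambda_0)}{a(\lambda_j+\lambda_0)}, \] \[ M_i=\frac{b(2\lambda_i)}{a(2\lambda_i)}\frac{c(\lambda_i-\lambda_0)}{b(\lambda_i-\lambda_0)}\Lambda_{\mathcal{A}}(\lambda_i)\prod_{\substack{j=1\\ j\neq i}}^{L}\frac{a(\lambda_j-\lambda_i)}{b(\lambda_j-\lambda_i)}\frac{b(\lambda_j+\lambda_i)}{a(\lambda_j+\lambda_i)} +\frac{c(\lambda_i+\lambda_0)}{a(\lambda_i+\lambda_0)}\Lambda_{\tilde{\mathcal{D}}}(\lambda_i)\prod_{\substack{j=1\\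 j\neq i}}^{L}\frac{a(\lambda_i-\lambda_j)}{b(\lambda_i-\lambda_j)}\frac{a(\lambda_i+\lambda_j+\gamma)}{b(\lambda_i+\lambda_j+\gamma)}, \] and \[ \Lambda_{\mathcal{A}}(\lambda)=b(h+\lambda)\prod_{j=1}^{L}a(\lambda-\mu_j)a(\lambda+\mu_j),\qquad \Lambda_{\tilde{\mathcal{D}}}(\lambda)=-\frac{b(2\lambda)}{a(2\lambda)}a(\lambda-h)\prod_{j=1}^{L}b(\lambda-\mu_j)b(\lambda+\mu_j), \] \[ \bar\Lambda_{\mathcal{A}}(\lambda)=\frac{c(2\lambda)}{a(2\lambda)}b(h-\lambda)\prod_{j=1}^{L}a(\lambda-\mu_j)a(\lambda+\mu_j)+\frac{b(2\lambda)}{a(2\lambda)}a(\lambda+h)\prod_{j=1}^{L}b(\lambda-\mu_j)b(\lambda+\mu_j). \]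
   Context: Set $a(\lambda)=\sinh(\lambda+\gamma)$, $b(\lambda)=\sinh(\lambda)$, $c(\lambda)=\sinh(\gamma)$ (a constant function). The $R$-matrix $\mathcal{R}(\lambda)\in\mathrm{End}(\mathbb{C}^2\otimes\mathbb{C}^2)$ is, in the basis $e_1\otimes e_1,e_1\otimes e_2,e_2\otimes e_1,e_2\otimes e_2$, the matrix with rows $(a,0,0,0)$, $(0,b,c,0)$, $(0,c,b,0)$, $(0,0,0,a)$, all evaluated at $\lambda$. Let $\mathbb{V}_0\cong\mathbb{C}^2$ (auxiliary space) and $\mathbb{V}_{\mathcal{Q}}=(\mathbb{C}^2)^{\otimes L}$ with factors labelled $1,\dots,L$; $\mathcal{R}_{0j}$ denotes $\mathcal{R}$ acting on $\mathbb{V}_0$ and the $j$-th factor. Define $\tau(\lambda)=\mathcal{R}_{0L}(\lambda-\mu_L)\cdots\mathcal{R}_{02}(\lambda-\mu_2)\mathcal{R}_{01}(\lambda-\mu_1)$ and $\bar\tau(\lambda)=\mathcal{R}_{01}(\lambda+\mu_1)\mathcal{R}_{02}(\lambda+\mu_2)\cdots\mathcal{R}_{0L}(\lambda+\mu_L)$, and $\mathcal{K}(\lambda)=\mathrm{diag}(\sinh(h+\lambda),\sinh(h-\lambda))$ acting on $\mathbb{V}_0$. The double-row monodromy matrix is $\mathcal{T}(\lambda)=\tau(\lambda)\mathcal{K}(\lambda)\bar\tau(\lambda)$, written as a $2\times 2$ matrix in $\mathbb{V}_0$ as $\begin{pmatrix}\mathcal{A}(\lambda)&\mathcal{B}(\lambda)\\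 \mathcal{C}(\lambda)&\mathcal{D}(\lambda)\end{pmatrix}$ with entries in $\mathrm{End}(\mathbb{V}_{\mathcal{Q}})$. Let $|0\rangle=e_1^{\otimes L}$ and $\langle\bar0|$ the dual (transpose) of $e_2^{\otimes L}$, where $e_1=(1,0)^T$, $e_2=(0,1)^T$. The partition function is $\mathcal{Z}(\lambda_1,\dots,\lambda_L)=\langle\bar 0|\mathcal{B}(\lambda_1)\cdots\mathcal{B}(\lambda_L)|0\rangle$ (a function also of $\mu_j,\gamma,h$). *)

(* Defs.v *)
From mathcomp Require Import all_boot all_algebra.
From mathcomp Require Import complex Rstruct.
From Stdlib Require Import Reals.
Import GRing.Theory.
Local Open Scope ring_scope.

Definition C : Type := (Rdefinitions.R)[i].

Definition Cexp (z : C) : C :=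
  Complex (exp (Re z) * cos (Im z)) (exp (Re z) * sin (Im z)).
Definition Csinh (z : C) : C := (Cexp z - Cexp (- z)) / 2.

Definition wa (gam l : C) : C := Csinh (l + gam).
Definition wb (l : C) : C := Csinh l.
Definition wc (gam : C) (l : C) : C := Csinh gam.

(* R-matrix on C^2 (x) C^2; basis index 0 = e_1, 1 = e_2; entry (row x, column y) *)
Definition Rmat (gam l : C) (x y : 'I_2 * 'I_2) : C :=
  let: (a, b) := x in let: (a', b') := y in
  if a == b then (if (a' == a) && (b' == b) then wa gam l else 0)
  else if (a' == a) && (b' == b) then wb l
  else if (a' == b) && (b' == a) then wc gam l
  else 0.

(* quantum space (C^2)^{(x) L}: basis indexed by spin configurations *)
Definition spin (L : nat) := {ffun 'I_L -> 'I_2}.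

(* operators on V_0 (x) V_Q, as matrices indexed by basis states *)
Definition op (L : nat) := 'I_2 * spin L -> 'I_2 * spin L -> C.
Definition opmul L (A B : op L) : op L :=
  fun x y => \sum_(z : 'I_2 * spin L) A x z * B z y.
Definition opid L : op L := fun x y => if x == y then 1 else 0.
Arguments opmul {L}. Arguments opid {L}.

(* R_{0j}: acts on V_0 and the factor labelled j (j : 'I_L, label j+1) *)
Definition R0j L (gam l : C) (j : 'I_L) : op L :=
  fun x y => Rmat gam l (x.1, x.2 j) (y.1, y.2 j) *
             (if [forall k, (k != j) ==> (x.2 k == y.2 k)] then 1 else 0).
Arguments R0j {L}.

(* mu n = mu_n for n = 1..L *)
Definition tau L (gam : C) (mu : nat -> C) (l : C) : op L :=
  foldr (fun (j : 'I_L) (acc : op L) => opmul (R0j gam (l - mu j.+1) j) acc) (@opid L)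
        (rev (enum 'I_L)).
Definition taubar L (gam : C) (mu : nat -> C) (l : C) : op L :=
  foldr (fun (j : 'I_L) (acc : op L) => opmul (R0j gam (l + mu j.+1) j) acc) (@opid L)
        (enum 'I_L).
Definition Kop L (h l : C) : op L :=
  fun x y => if x == y then (if x.1 == 0 then Csinh (h + l) else Csinh (h - l))
             else 0.
Definition Tmon L gam mu h l : op L :=
  opmul (tau L gam mu l) (opmul (Kop L h l) (taubar L gam mu l)).

Definition qop (L : nat) := spin L -> spin L -> C.
Definition qmul L (A B : qop L) : qop L :=
  fun s t => \sum_(u : spin L) A s u * B u t.
Definition qid L : qop L := fun s t => if s == t then 1 else 0.
Arguments qmul {L}. Arguments qid {L}.

Definition Bop L gam mu h l : qop L :=
  fun s t => Tmon L gam mu h l (0, s) (1, t).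

(* Z(l_1,...,l_n) = <0bar| B(l_1) ... B(l_n) |0>,
   |0> = e_1^{(x) L}, <0bar| = (e_2^{(x) L})^T *)
Definition Zpf L gam mu h (ls : seq C) : C :=
  (foldr (fun l acc => qmul (Bop L gam mu h l) acc) (@qid L) ls)
    [ffun => 1] [ffun => 0].

Definition LamA L gam (mu : nat -> C) h (l : C) : C :=
  wb (h + l) * \prod_(1 <= j < L.+1) (wa gam (l - mu j) * wa gam (l + mu j)).
Definition LamDt L gam (mu : nat -> C) h (l : C) : C :=
  - (wb (2 * l) / wa gam (2 * l)) * wa gam (l - h) *
    \prod_(1 <= j < L.+1) (wb (l - mu j) * wb (l + mu j)).
Definition LamAbar L gam (mu : nat -> C) h (l : C) : C :=
  wc gam (2 * l) / wa gam (2 * l) * wb (h - l) *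
    \prod_(1 <= j < L.+1) (wa gam (l - mu j) * wa gam (l + mu j))
  + wb (2 * l) / wa gam (2 * l) * wa gam (l + h) *
    \prod_(1 <= j < L.+1) (wb (l - mu j) * wb (l + mu j)).

Definition M0 L gam mu h (lam : nat -> C) : C :=
  LamAbar L gam mu h (lam 0%N)
  - LamA L gam mu h (lam 0%N) *
    \prod_(1 <= j < L.+1)
      (wa gam (lam j - lam 0%N) / wb (lam j - lam 0%N) *
       (wb (lam j + lam 0%N) / wa gam (lam j + lam 0%N))).
Definition Mi L gam mu h (lam : nat -> C) (i : nat) : C :=
  wb (2 * lam i) / wa gam (2 * lam i) *
    (wc gam (lam i - lam 0%N) / wb (lam i - lam 0%N)) * LamA L gam mu h (lam i) *
    \prod_(1 <= j < L.+1 | j != i)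
      (wa gam (lam j - lam i) / wb (lam j - lam i) *
       (wb (lam j + lam i) / wa gam (lam j + lam i)))
  + wc gam (lam i + lam 0%N) / wa gam (lam i + lam 0%N) * LamDt L gam mu h (lam i) *
    \prod_(1 <= j < L.+1 | j != i)
      (wa gam (lam i - lam j) / wb (lam i - lam j) *
       (wa gam (lam i + lam j + gam) / wb (lam i + lam j + gam))).

(* Main.v *)
(** The double-row monodromy matrix satisfies Sklyanin's reflection equation: adding a
    site conjugates it by R-matrices ("dressing"), and the Yang-Baxter equation carries
    the reflection equation through this step.  Its components give exchange relations
    between A, B and the modified operator D~(u) = D(u) - c/a(2u) A(u).  With the action
    of A and D~ on the reference state (also found by dressing) they yield the off-shell
    formula for A(l_0) B(l_1) ... B(l_L) |0>.  Pairing it with <0bar|, which is a left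
    eigenvector of A(l_0) with eigenvalue LamAbar(l_0), gives the functional equation. *)

From Stdlib Require Import Reals.
From HB Require Import structures.
From mathcomp Require Import all_boot all_algebra ring.
From mathcomp Require Import complex Rstruct.
Require Import Defs.
Import GRing.Theory.
Local Open Scope ring_scope.

(** Since R(w) R(-w) is scalar, the factor R(u + mu) to the right of K is up to a scalar the inverse
    of R(-u - mu). This is why dressing is a conjugation with reflected parameter; the proof uses
    the inverse-free form, so no R-matrix has to be invertible. The coefficient c/a(2u) in D~ is
    forced by the reference state. Each site adds a multiple of the A eigenvalue to that of D, and
    a(w-m) a(w+m) = b(w-m) b(w+m) + c a(2w) keeps the ratio at c/a(2w); subtracting it leaves a
    single product. The relation for D B contains A(u) B(v) and A(v) B(u). Expressing it through D~
    needs the A B relation at both orders of the parameters, hence a division by b(u+v), which may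
    vanish. In the off-shell formula, reading off one unwanted coefficient and invoking symmetry in
    the parameters would presuppose linearly independent vectors. The induction instead recombines
    all coefficients by explicit identities, for A and D~ together. *)

Lemma CexpD x y : Cexp (x + y) = Cexp x * Cexp y.
Proof.
case: x => a b; case: y => c d; rewrite /Cexp /=.
rewrite exp_plus cos_plus sin_plus.
rewrite /GRing.mul /=; congr Complex; rewrite ?(RmultE, RminusE, RplusE, RoppE); ring.
Qed.

Lemma Cexp0 : Cexp 0 = 1.
Proof. by rewrite /Cexp /= exp_0 cos_0 sin_0 mulr0 mulr1. Qed.

Lemma Cexp_neq0 x : Cexp x != 0.
Proof.
apply/eqP => ex0; move/eqP: (oner_neq0 C); apply.
by rewrite -[RHS](mul0r (Cexp (- x))) -ex0 -CexpD subrr Cexp0.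
Qed.

Lemma CexpN x : Cexp (- x) = (Cexp x)^-1.
Proof.
by apply: (mulfI (Cexp_neq0 x)); rewrite -CexpD subrr Cexp0 divff ?Cexp_neq0.
Qed.

(** * Operators on two auxiliary spaces *)

(* An operator on V_1 (x) V_2 (x) V_Q is a 2x2 matrix (indexed by V_1) of 2x2 matrices
   (indexed by V_2) with entries in End(V_Q).  The definitions are locked because
   unification would otherwise unfold them down to the complex entries. *)
HB.lock Definition in1 (A : pzRingType) (X : 'M[A]_2) : 'M['M[A]_2]_2 :=
  map_mx (@scalar_mx A 2) X.
HB.lock Definition in2 (A : pzRingType) (X : 'M[A]_2) : 'M['M[A]_2]_2 := X%:M.
HB.lock Definition Rmx (N : nat) (gam w : C) : 'M['M['M[C]_N]_2]_2 :=
  \matrix_(i, j) \matrix_(k, l) (Rmat gam w (i, k) (j, l))%:M.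
Arguments in1 {A}. Arguments in2 {A}.

Section Embeddings.
Variable A : pzRingType.
Implicit Types X Y : 'M[A]_2.

Lemma in1E X i j k l : in1 X i j k l = X i j *+ (k == l).
Proof. by rewrite unlock !mxE. Qed.

Lemma in2E X i j : in2 X i j = X *+ (i == j).
Proof. by rewrite unlock mxE. Qed.

Lemma in1M X Y : in1 (X * Y) = in1 X * in1 Y.
Proof. rewrite unlock; exact: (rmorphM (map_mx (@scalar_mx A 2))). Qed.

Lemma in2M X Y : in2 (X * Y) = in2 X * in2 Y.
Proof. rewrite unlock; exact: scalar_mxM. Qed.

Lemma mul_in1 (U : 'M['M[A]_2]_2) X i j k l :
  (U * in1 X) i j k l = \sum_p U i p k l * X p j.
Proof.
rewrite mxE summxE; apply: eq_bigr => p _; rewrite mxE.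
rewrite (bigD1 l) //= big1 ?addr0 => [|m /negPf km]; first by rewrite in1E eqxx.
by rewrite in1E km mulr0.
Qed.

Lemma in1_mul (U : 'M['M[A]_2]_2) X i j k l :
  (in1 X * U) i j k l = \sum_p X i p * U p j k l.
Proof.
rewrite mxE summxE; apply: eq_bigr => p _; rewrite mxE.
rewrite (bigD1 k) //= big1 ?addr0 => [|m /negPf km]; first by rewrite in1E eqxx.
by rewrite in1E eq_sym km mul0r.
Qed.

Lemma mul_in2 (U : 'M['M[A]_2]_2) X i j k l :
  (U * in2 X) i j k l = \sum_q U i j k q * X q l.
Proof.
rewrite mxE summxE (bigD1 j) //= big1 ?addr0 => [|m /negPf mj]; last first.
  by rewrite in2E mj mulr0 mxE.
by rewrite in2E eqxx mxE.
Qed.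

Lemma in2_mul (U : 'M['M[A]_2]_2) X i j k l :
  (in2 X * U) i j k l = \sum_q X k q * U i j q l.
Proof.
rewrite mxE summxE (bigD1 i) //= big1 ?addr0 => [|m /negPf mj]; last first.
  by rewrite in2E eq_sym mj mul0r mxE.
by rewrite in2E eqxx mxE.
Qed.

Lemma in1_in2E X Y i j k l : (in1 X * in2 Y) i j k l = X i j * Y k l.
Proof.
rewrite mul_in2 (bigD1 k) //= big1 ?addr0 => [|m /negPf km]; first by rewrite in1E eqxx.
by rewrite in1E eq_sym km mul0r.
Qed.

Lemma in2_in1E X Y i j k l : (in2 Y * in1 X) i j k l = Y k l * X i j.
Proof.
rewrite in2_mul (bigD1 l) //= big1 ?addr0 => [|m /negPf km]; first by rewrite in1E eqxx.
by rewrite in1E km mulr0.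
Qed.

Lemma in1_in2_comm (X Y : 'M[A]_2) :
  (forall i j k l, X i j * Y k l = Y k l * X i j) -> in1 X * in2 Y = in2 Y * in1 X.
Proof.
move=> XY; apply/matrixP => i j; apply/matrixP => k l.
by rewrite in1_in2E in2_in1E.
Qed.

End Embeddings.

Section Rmx.
Variable N : nat.
Notation A := 'M[C]_N.
Implicit Types X Y : 'M[A]_2.

Lemma RmxE gam w i j k l : Rmx N gam w i j k l = (Rmat gam w (i, k) (j, l))%:M.
Proof. by rewrite unlock !mxE. Qed.

Lemma mul_Rmx (U : 'M['M[A]_2]_2) gam w i j k l :
  (U * Rmx N gam w) i j k l = \sum_p \sum_q Rmat gam w (p, q) (j, l) *: U i p k q.
Proof.
rewrite mxE summxE; apply: eq_bigr => p _; rewrite mxE; apply: eq_bigr => q _.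
by rewrite RmxE [LHS]mul_mx_scalar.
Qed.

Lemma Rmx_mul (U : 'M['M[A]_2]_2) gam w i j k l :
  (Rmx N gam w * U) i j k l = \sum_p \sum_q Rmat gam w (i, k) (p, q) *: U p j q l.
Proof.
rewrite mxE summxE; apply: eq_bigr => p _; rewrite mxE; apply: eq_bigr => q _.
by rewrite RmxE [LHS]mul_scalar_mx.
Qed.

Lemma in1_Rmx_in2E X Y gam w i j k l :
  (in1 X * Rmx N gam w * in2 Y) i j k l =
    \sum_p \sum_q Rmat gam w (p, k) (j, q) *: (X i p *m Y q l).
Proof.
rewrite -mulrA in1_mul; apply: eq_bigr => p _; rewrite mul_in2 mulr_sumr; apply: eq_bigr => q _.
by rewrite RmxE [_ * Y q l]mul_scalar_mx scalemxAr.
Qed.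

Lemma in2_Rmx_in1E X Y gam w i j k l :
  (in2 Y * Rmx N gam w * in1 X) i j k l =
    \sum_p \sum_q Rmat gam w (i, q) (p, l) *: (Y k q *m X p j).
Proof.
rewrite mul_in1; apply: eq_bigr => p _; rewrite in2_mul mulr_suml; apply: eq_bigr => q _.
by rewrite RmxE [Y k q * _]mul_mx_scalar scalemxAl.
Qed.

End Rmx.

(** * Yang-Baxter equation *)

(* [Rmat] with spins in [bool], where case analysis computes. *)
Definition bweight (F : comPzRingType) (a b c : F) (x y x' y' : bool) : F :=
  if x == y then (if (x' == x) && (y' == y) then a else 0)
  else if (x' == x) && (y' == y) then b
  else if (x' == y) && (y' == x) then c else 0.
Arguments bweight {F}.

Lemma bweightC (F : comPzRingType) (a b c : F) x y x' y' :
  bweight a b c x y x' y' = bweight a b c y x y' x'.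
Proof. by case: x; case: y; case: x'; case: y'. Qed.

(** The ice rule leaves so few terms that each of the 64 entries is trivial, follows from
    commutativity, or is one of the three hypotheses. For hyperbolic weights these are the two
    three-term identities below with [q] equal to [gam]. *)
Lemma bweight_YBE (F : comNzRingType) (a1 b1 a2 b2 a3 b3 c : F) i k m j l n :
  a1 * b2 = a2 * b1 + b3 * c -> a1 * a3 = a2 * c + b1 * b3 -> b2 * a3 = a2 * b3 + b1 * c ->
  \sum_(p : bool) \sum_(q : bool) \sum_(r : bool)
    bweight a1 b1 c i k p q * bweight a2 b2 c p m j r * bweight a3 b3 c q r l n =
  \sum_(p : bool) \sum_(q : bool) \sum_(r : bool)
   bweight a1 b1 c p q j l * bweight a2 b2 c i r p n * bweight a3 b3 c k m q r.
Proof.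
move=> E1 E2 E3; rewrite !big_bool.
case: i; case: k; case: m; case: j; case: l; case: n;
  rewrite /bweight /= ?(mul0r, mulr0, add0r, addr0);
  first [reflexivity | ring | ring : E1 | ring : E2 | ring : E3].
Qed.

Lemma ord2_cases (x : 'I_2) : x = 0 \/ x = 1.
Proof. by case: x => [[|[|]]] //= H; [left|right]; apply: val_inj. Qed.

Lemma Rmat_bweight gam w i k j l : Rmat gam w (i, k) (j, l) =
  bweight (wa gam w) (wb w) (Csinh gam) (i == 1) (k == 1) (j == 1) (l == 1).
Proof.
by case: (ord2_cases i) => ->; case: (ord2_cases k) => ->;
   case: (ord2_cases j) => ->; case: (ord2_cases l) => ->.
Qed.

Lemma sum_ord2_bool (V : nmodType) (F : bool -> V) :
  \sum_(p : 'I_2) F (p == 1) = \sum_(p : bool) F p.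
Proof. by rewrite big_bool !big_ord_recl big_ord0 addr0 addrC. Qed.

Lemma Csinh_three_term1 x y q :
  Csinh (x + q) * Csinh (x + y) = Csinh (x + y + q) * Csinh x + Csinh y * Csinh q.
Proof.
rewrite /Csinh !(CexpD, CexpN, opprD, opprK).
field. by rewrite !Cexp_neq0.
Qed.

Lemma Csinh_three_term2 x y q :
  Csinh (x + q) * Csinh (y + q) = Csinh (x + y + q) * Csinh q + Csinh x * Csinh y.
Proof.
rewrite /Csinh !(CexpD, CexpN, opprD, opprK).
field. by rewrite !Cexp_neq0.
Qed.

Lemma Rmat_YBE gam u v i k m j l n :
  \sum_(p : 'I_2) \sum_(q : 'I_2) \sum_(r : 'I_2)
    Rmat gam u (i, k) (p, q) * Rmat gam (u + v) (p, m) (j, r) * Rmat gam v (q, r) (l, n) =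
  \sum_(p : 'I_2) \sum_(q : 'I_2) \sum_(r : 'I_2)
    Rmat gam u (p, q) (j, l) * Rmat gam (u + v) (i, r) (p, n) * Rmat gam v (k, m) (q, r).
Proof.
have S3 (F : bool -> bool -> bool -> C) :
   \sum_(p : 'I_2) \sum_(q : 'I_2) \sum_(r : 'I_2) F (p == 1) (q == 1) (r == 1)
   = \sum_(p : bool) \sum_(q : bool) \sum_(r : bool) F p q r.
  rewrite -sum_ord2_bool; apply: eq_bigr => p _.
  by rewrite -sum_ord2_bool; apply: eq_bigr => q _; rewrite -sum_ord2_bool.
under eq_bigr do under eq_bigr do under eq_bigr do rewrite !Rmat_bweight.
under [RHS]eq_bigr do under eq_bigr do under eq_bigr do rewrite !Rmat_bweight.
rewrite (S3 (fun p q r => bweight _ _ _ _ _ p q * bweight _ _ _ p _ _ r * bweight _ _ _ q r _ _)).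
rewrite (S3 (fun p q r => bweight _ _ _ p q _ _ * bweight _ _ _ _ r p _ * bweight _ _ _ _ _ q r)).
apply: bweight_YBE; rewrite /wa /wb.
- exact: Csinh_three_term1.
- exact: Csinh_three_term2.
- by rewrite mulrC [u + v]addrC Csinh_three_term1.
Qed.

(* [phi] embeds End(C^2) into End(V_Q) at one site. *)
HB.lock Definition lax (N : nat) (phi : 'M[C]_2 -> 'M[C]_N) gam w : 'M['M[C]_N]_2 :=
  \matrix_(i, j) phi (\matrix_(m, n) Rmat gam w (i, m) (j, n)).
Arguments lax {N}.

Section Lax.
Variables (N : nat) (phi : {linear 'M[C]_2 -> 'M[C]_N}).
Hypothesis phiM : forall X Y, phi (X *m Y) = phi X *m phi Y.

Lemma laxE gam w i j : lax phi gam w i j = phi (\matrix_(m, n) Rmat gam w (i, m) (j, n)).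
Proof. by rewrite unlock mxE. Qed.

(** This is the Yang-Baxter equation with its third space sent to the site: linearity and
    multiplicativity gather each side under a single [phi]. *)
Lemma Rmx_lax_lax gam u v :
  Rmx N gam (u - v) * in1 (lax phi gam u) * in2 (lax phi gam v) =
  in2 (lax phi gam v) * in1 (lax phi gam u) * Rmx N gam (u - v).
Proof.
apply/matrixP => i j; apply/matrixP => k l.
rewrite -mulrA Rmx_mul mul_Rmx.
under eq_bigr do under eq_bigr do rewrite in1_in2E !laxE -[_ * _]phiM -linearZ.
under [RHS]eq_bigr do under eq_bigr do rewrite in2_in1E !laxE -[_ * _]phiM -linearZ.
under eq_bigr do rewrite -linear_sum; under [RHS]eq_bigr do rewrite -linear_sum.
rewrite -!linear_sum; congr (phi _); apply/matrixP => m n; rewrite !summxE.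
have := Rmat_YBE gam (u - v) v i k m j l n; rewrite subrK => E.
under eq_bigr do (rewrite summxE; under eq_bigr do
  (rewrite !mxE mulr_sumr; under eq_bigr do rewrite !mxE mulrA)).
rewrite E; apply: eq_bigr => p _; rewrite summxE; apply: eq_bigr => q _.
rewrite !mxE mulr_sumr; apply: eq_bigr => r _; rewrite !mxE; ring.
Qed.

Lemma RmatC gam w i j k l : Rmat gam w (i, k) (j, l) = Rmat gam w (k, i) (l, j).
Proof. by rewrite !Rmat_bweight bweightC. Qed.

(** Up to scalars this is the previous relation at [- u], with R and the first factor inverted. It
    is obtained without inverses by letting the site be the second space of the Yang-Baxter equation
    and the other auxiliary space the third. *)
Lemma lax_Rmx_lax gam u v :
  in1 (lax phi gam u) * Rmx N gam (u + v) * in2 (lax phi gam v) =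
  in2 (lax phi gam v) * Rmx N gam (u + v) * in1 (lax phi gam u).
Proof.
apply/matrixP => i j; apply/matrixP => k l.
rewrite in1_Rmx_in2E in2_Rmx_in1E.
under eq_bigr do under eq_bigr do rewrite !laxE -phiM -linearZ.
under [RHS]eq_bigr do under eq_bigr do rewrite !laxE -phiM -linearZ.
under eq_bigr do rewrite -linear_sum; under [RHS]eq_bigr do rewrite -linear_sum.
rewrite -!linear_sum; congr (phi _); apply/matrixP => m n; rewrite !summxE.
have E := Rmat_YBE gam u v i m k j n l.
transitivity (\sum_(p < 2) \sum_(q < 2) \sum_(r < 2)
    Rmat gam u (i, m) (p, q) * Rmat gam (u + v) (p, k) (j, r) * Rmat gam v (q, r) (n, l)).
  apply: eq_bigr => p _; rewrite exchange_big summxE; apply: eq_bigr => q _.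
  rewrite !mxE mulr_sumr; apply: eq_bigr => r _; rewrite !mxE [Rmat gam v _ _]RmatC; ring.
rewrite E; apply: eq_bigr => p _; rewrite exchange_big summxE; apply: eq_bigr => q _.
rewrite !mxE mulr_sumr; apply: eq_bigr => r _; rewrite !mxE [Rmat gam v _ _]RmatC; ring.
Qed.

End Lax.

(** * Reflection equation *)

(** The algebra of dressing, free of indices. The last four commutations hold in the application
    because the two operators act on different auxiliary spaces and on different sites. *)
Lemma reflection_dressing (A : pzRingType) (Rm Rp L1 L1' T1 L2 L2' T2 : A) :
  Rm * L1 * L2 = L2 * L1 * Rm -> Rm * L1' * L2' = L2' * L1' * Rm ->
  L1' * Rp * L2 = L2 * Rp * L1' -> L1 * Rp * L2' = L2' * Rp * L1 ->
  T1 * L2 = L2 * T1 -> T1 * L2' = L2' * T1 -> L1 * T2 = T2 * L1 -> L1' * T2 = T2 * L1' ->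
  Rm * T1 * Rp * T2 = T2 * Rp * T1 * Rm ->
  Rm * (L1 * T1 * L1') * Rp * (L2 * T2 * L2') = L2 * T2 * L2' * Rp * (L1 * T1 * L1') * Rm.
Proof.
move=> Y Y' Z Z' c c' d d' E.
(* Products are kept associated to the left, so each relation is restated behind an arbitrary prefix
   [x]. *)
have zE x : x * L1' * Rp * L2 = x * L2 * Rp * L1' by rewrite -!mulrA; congr (x * _);
  rewrite !mulrA Z ?mulrA.
have z'E x : x * L1 * Rp * L2' = x * L2' * Rp * L1 by rewrite -!mulrA; congr (x * _);
  rewrite !mulrA Z' ?mulrA.
have y'E x : x * Rm * L1' * L2' = x * L2' * L1' * Rm by rewrite -!mulrA; congr (x * _);
  rewrite !mulrA Y' ?mulrA.
have eE x : x * Rm * T1 * Rp * T2 = x * T2 * Rp * T1 * Rm.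
  by rewrite -!mulrA; congr (x * _); rewrite !mulrA.
have cE x : x * T1 * L2 = x * L2 * T1 by rewrite -!mulrA c.
have c'E x : x * T1 * L2' = x * L2' * T1 by rewrite -!mulrA c'.
have dE x : x * L1 * T2 = x * T2 * L1 by rewrite -!mulrA d.
have d'E x : x * L1' * T2 = x * T2 * L1' by rewrite -!mulrA d'.
(* [L2] moves left until it meets [L1], which lets [Rm] pass inwards to the bare equation [eE]; [Rm]
   then leaves on the right and the outer factors are sorted back. *)
by rewrite !mulrA zE cE d'E Y eE y'E c'E dE z'E.
Qed.

Lemma Rmx_in1_Rmx_in2E N gam w w' (X Y : 'M['M[C]_N]_2) i j k l :
  (Rmx N gam w * in1 X * Rmx N gam w' * in2 Y) i j k l =
  \sum_p \sum_q Rmat gam w (i, k) (p, q) *: (in1 X * Rmx N gam w' * in2 Y) p j q l.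
Proof. by rewrite -!mulrA Rmx_mul. Qed.

Definition reflection_equation gam N (T : C -> 'M['M[C]_N]_2) := forall u v,
  Rmx N gam (u - v) * in1 (T u) * Rmx N gam (u + v) * in2 (T v) =
  in2 (T v) * Rmx N gam (u + v) * in1 (T u) * Rmx N gam (u - v).

(** The inhomogeneity enters the two factors with opposite signs, so that it cancels from u - v
    within each factor and from u + v across them. *)
Lemma reflection_equation_dress gam N (phi : {linear 'M[C]_2 -> 'M[C]_N}) (mu : C)
    (T : C -> 'M['M[C]_N]_2) :
  (forall X Y, phi (X *m Y) = phi X *m phi Y) ->
  (forall u i j X, phi X *m T u i j = T u i j *m phi X) ->
  reflection_equation gam N T ->
  reflection_equation gam N (fun u => lax phi gam (u - mu) * T u * lax phi gam (u + mu)).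
Proof.
move=> phiM phiT E u v; rewrite !in1M !in2M; apply: reflection_dressing.
- have -> : u - v = (u - mu) - (v - mu) by ring.
  exact: Rmx_lax_lax.
- have -> : u - v = (u + mu) - (v + mu) by ring.
  exact: Rmx_lax_lax.
- have -> : u + v = (u + mu) + (v - mu) by ring.
  exact: lax_Rmx_lax.
- have -> : u + v = (u - mu) + (v + mu) by ring.
  exact: lax_Rmx_lax.
- by apply: in1_in2_comm => i j k l; rewrite laxE -[LHS]phiT.
- by apply: in1_in2_comm => i j k l; rewrite laxE -[LHS]phiT.
- by apply: in1_in2_comm => i j k l; rewrite laxE [LHS]phiT.
- by apply: in1_in2_comm => i j k l; rewrite laxE [LHS]phiT.
- exact: E.
Qed.

HB.lock Definition kmx (N : nat) (h w : C) : 'M['M[C]_N]_2 :=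
  \matrix_(i, j) ((if i == 0 then Csinh (h + w) else Csinh (h - w)) *+ (i == j))%:M.

Lemma kmxE N h w i j : kmx N h w i j =
  ((if i == 0 then Csinh (h + w) else Csinh (h - w)) *+ (i == j))%:M.
Proof. by rewrite unlock mxE. Qed.

(** As K is diagonal, [E1] and [E2] collapse the inner sums to one scalar weight each. What remains
    is 16 scalar identities, settled by commutativity or by expanding into exponentials. *)
Lemma reflection_equation_kmx gam N h : reflection_equation gam N (kmx N h).
Proof.
move=> u v; apply/matrixP => i j; apply/matrixP => k l.
pose kd w (b : bool) := if b then Csinh (h - w) else Csinh (h + w).
have kE w a b : kmx N h w a b = (kd w (a == 1) *+ (a == b))%:M.
  rewrite kmxE /kd; congr (_ *+ _)%:M; by case: a => [[|[|]]].
have E1 a b c d : (in1 (kmx N h u) * Rmx N gam (u + v) * in2 (kmx N h v)) a b c d =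
   (kd u (a == 1) * Rmat gam (u + v) (a, c) (b, d) * kd v (d == 1))%:M.
  rewrite in1_Rmx_in2E (bigD1 a) // [X in _ + X = _]big1 ?addr0; last first.
    move=> p pa; apply: big1 => q _.
    by rewrite !kE [a == p]eq_sym (negPf pa) mulr0n -scalar_mxM mul0r scale_scalar_mx mulr0
      raddf0.
  rewrite (bigD1 d) // [X in _ + X = _]big1 ?addr0; last first.
    by move=> p pd; rewrite !kE (negPf pd) mulr0n -scalar_mxM mulr0 scale_scalar_mx mulr0 raddf0.
  by rewrite !kE !eqxx !mulr1n -scalar_mxM scale_scalar_mx mulrCA mulrA.
have E2 a b c d : (in2 (kmx N h v) * Rmx N gam (u + v) * in1 (kmx N h u)) a b c d =
   (kd v (c == 1) * Rmat gam (u + v) (a, c) (b, d) * kd u (b == 1))%:M.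
  rewrite in2_Rmx_in1E (bigD1 b) // [X in _ + X = _]big1 ?addr0; last first.
    move=> p pa; apply: big1 => q _.
    by rewrite !kE (negPf pa) mulr0n -scalar_mxM mulr0 scale_scalar_mx mulr0 raddf0.
  rewrite (bigD1 c) // [X in _ + X = _]big1 ?addr0; last first.
    move=> p pd.
    by rewrite !kE [c == p]eq_sym (negPf pd) mulr0n -scalar_mxM mul0r scale_scalar_mx mulr0
      raddf0.
  by rewrite !kE !eqxx !mulr1n -scalar_mxM scale_scalar_mx mulrCA mulrA.
rewrite Rmx_in1_Rmx_in2E [RHS]mul_Rmx.
under eq_bigr do under eq_bigr do rewrite E1 Rmat_bweight Rmat_bweight scale_scalar_mx.
under [RHS]eq_bigr do under eq_bigr do rewrite E2 Rmat_bweight Rmat_bweight scale_scalar_mx.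
have S2 (F : bool -> bool -> C) :
   \sum_(p : 'I_2) \sum_(q : 'I_2) (F (p == 1) (q == 1))%:M
   = (\sum_(p : bool) \sum_(q : bool) F p q)%:M :> 'M[C]_N.
  rewrite raddf_sum -sum_ord2_bool; apply: eq_bigr => p _.
  by rewrite raddf_sum -sum_ord2_bool.
rewrite (S2 (fun p q => bweight _ _ _ _ _ p q * (kd u p * bweight _ _ _ p q _ _ * _))).
rewrite (S2 (fun p q => bweight _ _ _ p q _ _ * (_ * bweight _ _ _ _ _ p q * kd u p))).
congr (_%:M).
move: (i == 1) (k == 1) (j == 1) (l == 1) => {E1 E2 S2 kE} {}i {}k {}j {}l.
rewrite /kd !big_bool; case: i; case: k; case: j; case: l;
  rewrite /bweight /= ?(mul0r, mulr0, add0r, addr0).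
all: try reflexivity.
all: try ring.
all: rewrite /wa /wb /Csinh !(CexpD, CexpN, opprD, opprK, invrK).
all: field; by rewrite !Cexp_neq0.
Qed.

(** * Component form of the reflection equation *)

Lemma sum_ord2 (V : nmodType) (F : 'I_2 -> V) : \sum_p F p = F 0 + F 1.
Proof. by rewrite !big_ord_recl big_ord0 addr0; congr (_ + F _); apply: val_inj. Qed.

(** This lemma and the next three cover the four index patterns of [reflection_entries]: outer and
    inner R-matrix on either side. Each bundles its four cases as a product type, so that it acts as
    one multirule for [rewrite]. *)
Lemma Rmat_row (V : lmodType C) gam w (F : 'I_2 -> 'I_2 -> V) :
  ((\sum_p \sum_q Rmat gam w (0, 0) (p, q) *: F p q = wa gam w *: F 0 0)%R *
   (\sum_p \sum_q Rmat gam w (0, 1) (p, q) *: F p q = wb w *: F 0 1 + wc gam w *: F 1 0)%R *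
   (\sum_p \sum_q Rmat gam w (1, 0) (p, q) *: F p q = wc gam w *: F 0 1 + wb w *: F 1 0)%R *
   (\sum_p \sum_q Rmat gam w (1, 1) (p, q) *: F p q = wa gam w *: F 1 1)%R)%type.
Proof. by split; [split; [split|]|]; rewrite !sum_ord2 /= ?scale0r ?(add0r, addr0). Qed.

Lemma Rmat_col (V : lmodType C) gam w (F : 'I_2 -> 'I_2 -> V) :
  ((\sum_p \sum_q Rmat gam w (p, q) (0, 0) *: F p q = wa gam w *: F 0 0)%R *
   (\sum_p \sum_q Rmat gam w (p, q) (0, 1) *: F p q = wb w *: F 0 1 + wc gam w *: F 1 0)%R *
   (\sum_p \sum_q Rmat gam w (p, q) (1, 0) *: F p q = wc gam w *: F 0 1 + wb w *: F 1 0)%R *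
   (\sum_p \sum_q Rmat gam w (p, q) (1, 1) *: F p q = wa gam w *: F 1 1)%R)%type.
Proof. by split; [split; [split|]|]; rewrite !sum_ord2 /= ?scale0r ?(add0r, addr0). Qed.

Lemma Rmat_anti (V : lmodType C) gam w (F : 'I_2 -> 'I_2 -> V) :
  ((\sum_p \sum_q Rmat gam w (p, 0) (0, q) *: F p q = wa gam w *: F 0 0 + wc gam w *: F 1 1)%R *
   (\sum_p \sum_q Rmat gam w (p, 0) (1, q) *: F p q = wb w *: F 1 0)%R *
   (\sum_p \sum_q Rmat gam w (p, 1) (0, q) *: F p q = wb w *: F 0 1)%R *
   (\sum_p \sum_q Rmat gam w (p, 1) (1, q) *: F p q =
   wc gam w *: F 0 0 + wa gam w *: F 1 1)%R)%type.
Proof. by split; [split; [split|]|]; rewrite !sum_ord2 /= ?scale0r ?(add0r, addr0). Qed.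

Lemma Rmat_diag (V : lmodType C) gam w (F : 'I_2 -> 'I_2 -> V) :
  ((\sum_p \sum_q Rmat gam w (0, q) (p, 0) *: F p q = wa gam w *: F 0 0 + wc gam w *: F 1 1)%R *
   (\sum_p \sum_q Rmat gam w (0, q) (p, 1) *: F p q = wb w *: F 0 1)%R *
   (\sum_p \sum_q Rmat gam w (1, q) (p, 0) *: F p q = wb w *: F 1 0)%R *
   (\sum_p \sum_q Rmat gam w (1, q) (p, 1) *: F p q =
   wc gam w *: F 0 0 + wa gam w *: F 1 1)%R)%type.
Proof. by split; [split; [split|]|]; rewrite !sum_ord2 /= ?scale0r ?(add0r, addr0). Qed.

Section Components.
Variables (gam : C) (N : nat) (T : C -> 'M['M[C]_N]_2).
Hypothesis RE : reflection_equation gam N T.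
Let A w := T w 0 0. Let B w := T w 0 1. Let D w := T w 1 1.
Let a := wa gam. Let b := wb. Let c := Csinh gam.

Lemma reflection_entries u v i j k l :
  \sum_p \sum_q Rmat gam (u - v) (i, k) (p, q) *:
    (\sum_r \sum_s Rmat gam (u + v) (r, q) (j, s) *: (T u p r *m T v s l)) =
  \sum_p \sum_q Rmat gam (u - v) (p, q) (j, l) *:
    (\sum_r \sum_s Rmat gam (u + v) (i, s) (r, q) *: (T v k s *m T u r p)).
Proof.
under eq_bigr do under eq_bigr do rewrite -in1_Rmx_in2E.
under [RHS]eq_bigr do under eq_bigr do rewrite -in2_Rmx_in1E.
by rewrite -Rmx_in1_Rmx_in2E RE [LHS]mul_Rmx.
Qed.

Lemma reflection_BB u v :
  (a (u - v) * b (u + v)) *: (B u *m B v) = (a (u - v) * b (u + v)) *: (B v *m B u).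
Proof.
have := reflection_entries u v 0 1 0 1.
by rewrite Rmat_row Rmat_anti Rmat_col Rmat_diag !scalerA.
Qed.

Lemma reflection_BA u v : (a (u - v) * b (u + v)) *: (B u *m A v) =
  (b (u - v) * a (u + v)) *: (A v *m B u) + (b (u - v) * c) *: (B v *m D u)
  + (c * b (u + v)) *: (B v *m A u).
Proof.
have := reflection_entries u v 0 1 0 0.
rewrite Rmat_row Rmat_anti Rmat_col !Rmat_diag !(scalerDr, scalerA) => ->.
by rewrite addrC.
Qed.

Lemma reflection_DB u v :
  (b (u - v) * b (u + v)) *: (D u *m B v) + (c * a (u + v)) *: (B u *m D v)
  + (c * c) *: (A u *m B v) =
  (a (u - v) * a (u + v)) *: (B v *m D u) + (a (u - v) * c) *: (A v *m B u).
Proof.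
have := reflection_entries u v 1 1 0 1.
rewrite Rmat_row !Rmat_anti Rmat_col !Rmat_diag !(scalerDr, scalerA) => E.
rewrite addrC [X in _ + X]addrC addrA [RHS]addrC; exact: E.
Qed.

End Components.

(** * Laurent polynomials in exp *)

(* The reflection equation yields some exchange relations only up to factors such as
   a(u-v) b(u+v), which the theorem does not assume to be nonzero.  As Laurent
   polynomials in exp u form an integral domain, these factors can be cancelled. *)
Definition trig (f : C -> C) :=
  exists (p : {poly C}) n, forall u, f u * Cexp u ^+ n = p.[Cexp u].

Lemma trig_cst c : trig (fun=> c).
Proof. by exists c%:P, 0%N => u; rewrite hornerC mulr1. Qed.

Lemma trigD f g : trig f -> trig g -> trig (fun u => f u + g u).
Proof.
move=> [p [m pE]] [q [n qE]]; exists (p * 'X^n + q * 'X^m), (m + n)%N => u.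
by rewrite !hornerE -pE -qE exprD; ring.
Qed.

Lemma trigM f g : trig f -> trig g -> trig (fun u => f u * g u).
Proof.
move=> [p [m pE]] [q [n qE]]; exists (p * q), (m + n)%N => u.
by rewrite hornerM -pE -qE exprD; ring.
Qed.

Lemma trig_eq f g : f =1 g -> trig g -> trig f.
Proof. by move=> fg [p [n E]]; exists p, n => u; rewrite fg. Qed.

Lemma trigN f : trig f -> trig (fun u => - f u).
Proof. by move=> tf; apply: trig_eq (trigM _ _ (trig_cst (-1)) tf) => u; rewrite mulN1r. Qed.

Lemma trig_sum (I : finType) (F : I -> C -> C) : (forall i, trig (F i)) ->
  trig (fun u => \sum_i F i u).
Proof.
move=> tF; elim: (index_enum I) => [|i s IH].
  by apply: trig_eq (trig_cst 0) => u; rewrite big_nil.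
by apply: trig_eq (trigD _ _ (tF i) IH) => u; rewrite big_cons.
Qed.

Lemma trig_sinhDr c : trig (fun u => Csinh (u + c)).
Proof.
exists ((Cexp c / 2) *: 'X^2 - (Cexp (- c) / 2)%:P), 1%N => u.
rewrite !(hornerD, hornerN, hornerZ, hornerXn, hornerC) /Csinh !(CexpD, CexpN, opprD).
by field; rewrite !Cexp_neq0.
Qed.

Lemma trig_sinhB c : trig (fun u => Csinh (c - u)).
Proof.
exists (- (Cexp (- c) / 2) *: 'X^2 + (Cexp c / 2)%:P), 1%N => u.
rewrite !(hornerD, hornerN, hornerZ, hornerXn, hornerC) /Csinh !(CexpD, CexpN, opprD, opprK).
by field; rewrite !Cexp_neq0.
Qed.

Lemma trig_sinh2 c : trig (fun u => Csinh (2 * u + c)).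
Proof.
exists ((Cexp c / 2) *: 'X^4 - (Cexp (- c) / 2)%:P), 2%N => u.
rewrite mulr2n mulrDl mul1r !(hornerD, hornerN, hornerZ, hornerXn, hornerC) /Csinh
  !(CexpD, CexpN, opprD).
by field; rewrite !Cexp_neq0.
Qed.

Lemma Cexp_INR_inj : injective (fun n : nat => Cexp (Complex (INR n) 0)).
Proof.
move=> m n /=; rewrite /Cexp /= cos_0 !mulr1 => -[/exp_inv /INR_eq //].
Qed.

(** [p * q] vanishes at the pairwise distinct values of [Cexp] at the naturals, more of them than
    its degree allows, so it is zero. Polynomials form a domain, and [fu0] excludes [p = 0]. *)
Lemma trig_mul_eq0 f g : trig f -> trig g -> (forall u, f u * g u = 0) ->
  (exists u, f u != 0) -> forall u, g u = 0.
Proof.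
move=> [p [m pE]] [q [n qE]] fg0 [u0 fu0] u.
have pq0 : p * q = 0.
  apply/eqP/contraT => pq_neq0.
  pose rs := [seq Cexp (Complex (INR k) 0) | k <- iota 0 (size (p * q))].
  have : (size rs < size (p * q)%R)%N.
    apply: max_poly_roots => //.
      apply/allP => _ /mapP[k _ ->]; rewrite /root hornerM -pE -qE.
      by rewrite mulrACA fg0 mul0r.
    by rewrite map_inj_uniq ?iota_uniq //; apply: Cexp_INR_inj.
  by rewrite size_map size_iota ltnn.
have : q.[Cexp u] = 0.
  move/eqP: pq0; rewrite mulf_eq0 => /orP[] /eqP z0; last by rewrite z0 horner0.
  move: fu0; suff -> : f u0 = 0 by rewrite eqxx.
  by apply/eqP; rewrite -(mulIr_eq0 _ (mulIf (expf_neq0 m (Cexp_neq0 u0)))) pE z0 horner0.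
rewrite -qE => /eqP; rewrite mulf_eq0 => /orP[/eqP //|].
by rewrite (negPf (expf_neq0 n (Cexp_neq0 u))).
Qed.

Lemma Cexp2M x : Cexp (2 * x) = Cexp x * Cexp x.
Proof. by rewrite mulr2n mulrDl mul1r CexpD. Qed.

(** Expands exponentials of linear combinations into products over single variables, which turns
    hyperbolic identities into rational ones that [field] decides. *)
Definition CexpE := (CexpD, CexpN, Cexp2M, @opprD C, @opprK C).

(** * Exchange relations *)

(* Sklyanin's modified D operator. *)
HB.lock Definition opDt gam N (T : C -> 'M['M[C]_N]_2) w : 'M[C]_N :=
  T w 1 1 - (Csinh gam / wa gam (2 * w)) *: T w 0 0.
Arguments opDt gam {N} T.

Section Exchange.
Variables (gam : C) (N : nat) (T : C -> 'M['M[C]_N]_2).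
Hypothesis RE : reflection_equation gam N T.
Hypothesis trigT : forall i j s t, trig (fun u => T u i j s t).

Definition opA w : 'M[C]_N := T w 0 0.
Definition opB w : 'M[C]_N := T w 0 1.
Notation opD := (opDt gam T).

(** Coefficients for moving A (unprimed) or D~ (primed) at [u] past B at [v]: [f] keeps the
    parameters in place, [g] swaps them, [k] swaps them and also exchanges A with D~. *)
Definition coef_f u v := wa gam (v - u) / wb (v - u) * (wb (v + u) / wa gam (v + u)).
Definition coef_g u v := - (wb (2 * v) / wa gam (2 * v) * (Csinh gam / wb (v - u))).
Definition coef_k u v := - (Csinh gam / wa gam (v + u)).
Definition coef_f' u v := wa gam (u - v) / wb (u - v) * (wa gam (u + v + gam) / wb (u + v + gam)).
Definition coef_g' u v := - (Csinh gam * wa gam (2 * u + gam) / (wb (u - v) * wa gam (2 * u))).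
Definition coef_k' u v :=
  Csinh gam * wb (2 * v) * wa gam (2 * u + gam) /
    (wa gam (u + v) * wa gam (2 * u) * wa gam (2 * v)).

Lemma wbN w : wb (- w) = - wb w.
Proof. by rewrite /wb /Csinh opprK -mulNr opprB. Qed.

Lemma wbB u v : wb (u - v) = - wb (v - u).
Proof. by rewrite -wbN opprB. Qed.

Lemma mxDE m n (X Y : 'M[C]_(m, n)) i j : (X + Y) i j = X i j + Y i j.
Proof. by rewrite mxE. Qed.

Lemma mxNE m n (X : 'M[C]_(m, n)) i j : (- X) i j = - X i j.
Proof. by rewrite mxE. Qed.

Lemma mxZE m n c (X : 'M[C]_(m, n)) i j : (c *: X) i j = c * X i j.
Proof. by rewrite mxE. Qed.

Definition mx_linE := (mxDE, mxNE, mxZE).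

Lemma exchange_AB_entry u v s t :
  wa gam (v - u) * wb (u + v) * (opB v *m opA u) s t =
  wb (v - u) * wa gam (u + v) * (opA u *m opB v) s t
  + wb (v - u) * Csinh gam * (opB u *m T v 1 1) s t
  + Csinh gam * wb (u + v) * (opB u *m opA v) s t.
Proof.
have := congr1 (fun X : 'M[C]_N => X s t) (reflection_BA _ _ _ RE v u).
by rewrite /opA /opB [v + u]addrC !mx_linE => ->.
Qed.

Lemma exchange_AB u v : wb (v - u) != 0 -> wa gam (u + v) != 0 -> wa gam (2 * v) != 0 ->
  opA u *m opB v = coef_f u v *: (opB v *m opA u) + coef_g u v *: (opB u *m opA v)
    + coef_k u v *: (opB u *m opD v).
Proof.
move=> bm ap a2; apply/matrixP => s t; have := exchange_AB_entry u v s t.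
rewrite [opDt]unlock mulmxBr -!scalemxAr !mx_linE -/(opA v).
move: ((opB v *m opA u) s t) ((opA u *m opB v) s t) ((opB u *m T v 1 1) s t)
  ((opB u *m opA v) s t) => z1 x0 y2 z2 E.
(* Replacing D by D~ gives B(u) A(v) a second contribution; this identity merges the two into the
   product form of [coef_g]. *)
have H : wb (2 * v) = (wb (u + v) * wa gam (2 * v) + Csinh gam * wb (v - u)) / wa gam (u + v).
  apply: (mulIf ap); rewrite divfK // /wa /wb /Csinh !CexpE.
  by field; rewrite !Cexp_neq0.
rewrite /coef_f /coef_g /coef_k H [v + u]addrC; apply: (mulfI (mulf_neq0 bm ap)).
have -> : wb (v - u) * wa gam (u + v) * x0 = wa gam (v - u) * wb (u + v) * z1
    - wb (v - u) * Csinh gam * y2 - Csinh gam * wb (u + v) * z2 by rewrite E; ring.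
by field; rewrite bm ap a2.
Qed.

Lemma trig_mulmx (X Y : C -> 'M[C]_N) : (forall s t, trig (fun u => X u s t)) ->
  (forall s t, trig (fun u => Y u s t)) -> forall s t, trig (fun u => (X u *m Y u) s t).
Proof.
move=> tX tY s t; apply: trig_eq (trig_sum _ (fun j u => X u s j * Y u j t) _).
  by move=> u; rewrite mxE.
by move=> j; apply: trigM.
Qed.

Lemma wb_neq0 : exists w, wb w != 0.
Proof.
exists (Complex (INR 1) 0); set w := Complex _ _.
apply: mulf_neq0; last by rewrite invr_eq0 Num.Theory.pnatr_eq0.
rewrite subr_eq0.
apply/eqP => E; suff /Cexp_INR_inj : Cexp (Complex (INR 2) 0) = Cexp (Complex (INR 0) 0) by [].
have -> : Complex (INR 2) 0 = w + w by rewrite /w /GRing.add /= ?addr0.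
by rewrite CexpD {1}E -CexpD addNr.
Qed.

Lemma wb_shift_mul_eq0 c g : trig g -> (forall u, wb (u + c) * g u = 0) -> forall u, g u = 0.
Proof.
move=> tg fg; apply: (trig_mul_eq0 _ _ (trig_sinhDr c) tg fg).
by have [w nz] := wb_neq0; exists (w - c); rewrite subrK.
Qed.

(** The reflection equation gives this only multiplied by a(u-v) b(u+v). Both factors are shifts of
    [wb] in [u] and are cancelled one at a time, so no genericity of [u] and [v] remains. *)
Lemma opBC u v : opB u *m opB v = opB v *m opB u.
Proof.
apply/matrixP => s t; apply/subr0_eq; move: u.
have tr : trig (fun u => (opB u *m opB v) s t - (opB v *m opB u) s t).
  apply: (trigD _ _ (trig_mulmx opB (fun=> opB v) (trigT 0 1) _ s t)
    (trigN _ (trig_mulmx (fun=> opB v) opB _ (trigT 0 1) s t))) => ? ?; exact: trig_cst.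
apply: (wb_shift_mul_eq0 v _ tr).
apply: (wb_shift_mul_eq0 (gam - v) _ (trigM _ _ (trig_sinhDr _) tr)).
move=> u; have := congr1 (fun X : 'M[C]_N => X s t) (reflection_BB _ _ _ RE u v).
rewrite /= !mxZE -/(opB u) -/(opB v) => /eqP; rewrite -subr_eq0 -mulrBr => /eqP.
by rewrite /wa -mulrA -addrA [- v + _]addrC.
Qed.

(** The scalars stand for entries of operator products: [x0] of A(u)B(v), [x1] of A(v)B(u), [y0] of
    D(u)B(v), [y1] of B(v)D(u), [y2] of B(u)D(v), [z1] of B(v)A(u), [z2] of B(u)A(v). The hypotheses
    are the A B relation in both orders and the D B relation. *)
Lemma exchange_DB_generic u v (x0 y0 y1 y2 z1 z2 x1 : C) :
  wb (v - u) != 0 -> wa gam (u + v) != 0 -> wb (u + v) != 0 ->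
  wa gam (v - u) * wb (u + v) * z1 =
    wb (v - u) * wa gam (u + v) * x0 + wb (v - u) * Csinh gam * y2
    + Csinh gam * wb (u + v) * z2 ->
  wa gam (u - v) * wb (u + v) * z2 =
    wb (u - v) * wa gam (u + v) * x1 + wb (u - v) * Csinh gam * y1
    + Csinh gam * wb (u + v) * z1 ->
  wb (u - v) * wb (u + v) * y0 + Csinh gam * wa gam (u + v) * y2 + Csinh gam * Csinh gam * x0 =
    wa gam (u - v) * wa gam (u + v) * y1 + wa gam (u - v) * Csinh gam * x1 ->
  wb (u - v) * wa gam (u + v) * wa gam (2 * v) * (wa gam (2 * u) * y0 - Csinh gam * x0)
  = wa gam (u - v) * wa gam (u + v + gam) * wa gam (2 * v) *
      (wa gam (2 * u) * y1 - Csinh gam * z1)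
  - Csinh gam * wa gam (2 * u + gam) * wa gam (u + v) * (wa gam (2 * v) * y2 - Csinh gam * z2)
  + wb (u - v) * Csinh gam * wb (2 * v) * wa gam (2 * u + gam) * z2.
Proof.
move=> bm ap bp E1 E2 E3.
have nz : wb (u - v) * wb (u + v) != 0 by rewrite wbB mulf_neq0 ?oppr_eq0.
apply/(mulfI nz)/eqP; rewrite -subr_eq0; apply/eqP.
(* The difference of the two sides is a combination of the three hypotheses. *)
transitivity (wa gam (u + v) * wa gam (2 * v) * wa gam (2 * u) * wb (u - v) *
   ((wb (u - v) * wb (u + v) * y0 + Csinh gam * wa gam (u + v) * y2
     + Csinh gam * Csinh gam * x0) -
    (wa gam (u - v) * wa gam (u + v) * y1 + wa gam (u - v) * Csinh gam * x1))
 + (wb (u - v) * wb (u + v) * wa gam (2 * v) * Csinh gam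
    + wa gam (2 * v) * wa gam (2 * u) * Csinh gam ^+ 2) *
   ((wb (v - u) * wa gam (u + v) * x0 + wb (v - u) * Csinh gam * y2
     + Csinh gam * wb (u + v) * z2) - wa gam (v - u) * wb (u + v) * z1)
 + wa gam (2 * v) * wa gam (2 * u) * wa gam (u - v) * Csinh gam *
   (wb (u - v) * wa gam (u + v) * x1 + wb (u - v) * Csinh gam * y1
    + Csinh gam * wb (u + v) * z1 - wa gam (u - v) * wb (u + v) * z2)).
  rewrite /wa /wb /Csinh !CexpE.
  by field; rewrite !Cexp_neq0.
by rewrite -E1 -E2 E3 !subrr !mulr0 !addr0.
Qed.

Lemma trig_mulmxl (X : C -> 'M[C]_N) (Y : 'M[C]_N) s t :
  (forall s t, trig (fun u => X u s t)) -> trig (fun u => (X u *m Y) s t).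
Proof. by move=> tX; apply: (trig_mulmx X (fun=> Y) tX) => ? ?; exact: trig_cst. Qed.

Lemma trig_mulmxr (X : 'M[C]_N) (Y : C -> 'M[C]_N) s t :
  (forall s t, trig (fun u => Y u s t)) -> trig (fun u => (X *m Y u) s t).
Proof. by move=> tY; apply: (trig_mulmx (fun=> X) Y _ tY) => ? ?; exact: trig_cst. Qed.

(* The shape of the relation [exchange_DB_cleared] below.  With the functions abstracted,
   unification does not try to evaluate them. *)
Lemma trig_combination (b1 a1 a2 y0 x0 a3 a4 y1 z1 a5 y2 z2 : C -> C) (k c k' : C) :
  trig b1 -> trig a1 -> trig a2 -> trig y0 -> trig x0 -> trig a3 -> trig a4 -> trig y1 ->
  trig z1 -> trig a5 -> trig y2 -> trig z2 ->
  trig (fun u => b1 u * a1 u * k * (a2 u * y0 u - c * x0 u) -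
    (a3 u * a4 u * k * (a2 u * y1 u - c * z1 u) - c * a5 u * a1 u * (k * y2 u - c * z2 u)
     + b1 u * c * k' * a5 u * z2 u)).
Proof.
move=> *.
repeat match goal with
  | |- trig (fun u => @?F u + @?G u) => refine (trigD F G _ _)
  | |- trig (fun u => @?F u * @?G u) => refine (trigM F G _ _)
  | |- trig (fun u => - @?F u) => refine (trigN F _)
  | |- trig (fun u => ?c) => exact (trig_cst c)
  | H : trig ?f |- trig _ => exact H
  end.
Qed.

Lemma exchange_DB_cleared u v s t :
  wb (u - v) * wa gam (u + v) * wa gam (2 * v) *
    (wa gam (2 * u) * (T u 1 1 *m opB v) s t - Csinh gam * (opA u *m opB v) s t)
  = wa gam (u - v) * wa gam (u + v + gam) * wa gam (2 * v) *
      (wa gam (2 * u) * (opB v *m T u 1 1) s t - Csinh gam * (opB v *m opA u) s t)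
  - Csinh gam * wa gam (2 * u + gam) * wa gam (u + v) *
      (wa gam (2 * v) * (opB u *m T v 1 1) s t - Csinh gam * (opB u *m opA v) s t)
  + wb (u - v) * Csinh gam * wb (2 * v) * wa gam (2 * u + gam) * (opB u *m opA v) s t.
Proof.
apply/subr0_eq; move: u.
have tB X : trig (fun u => (opB u *m X) s t) by apply: trig_mulmxl; exact: (trigT 0 1).
have tA X : trig (fun u => (opA u *m X) s t) by apply: trig_mulmxl; exact: (trigT 0 0).
have tD X : trig (fun u => (T u 1 1 *m X) s t).
  by apply: (trig_mulmxl (fun u => T u 1 1)); exact: (trigT 1 1).
have tA' X : trig (fun u => (X *m opA u) s t) by apply: trig_mulmxr; exact: (trigT 0 0).
have tD' X : trig (fun u => (X *m T u 1 1) s t).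
  by apply: (trig_mulmxr X (fun u => T u 1 1)); exact: (trigT 1 1).
have tb c : trig (fun u => wb (u + c)) by exact: trig_sinhDr.
have ta c : trig (fun u => wa gam (u + c)).
  by apply: trig_eq (trig_sinhDr (c + gam)) => u; rewrite /wa addrA.
have ta' : trig (fun u => wa gam (u + v + gam)).
  by apply: trig_eq (ta (v + gam)) => u; rewrite addrA.
have ta2 : trig (fun u => wa gam (2 * u)) by exact: trig_sinh2.
have ta2' : trig (fun u => wa gam (2 * u + gam)).
  by apply: trig_eq (trig_sinh2 (gam + gam)) => u; rewrite /wa addrA.
match goal with |- forall u, @?F u = 0 => have tF : trig F end.
  exact: (trig_combination (fun u => wb (u - v)) (fun u => wa gam (u + v))
    (fun u => wa gam (2 * u))
    (fun u => (T u 1 1 *m opB v) s t) (fun u => (opA u *m opB v) s t) (fun u => wa gam (u - v))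
    (fun u => wa gam (u + v + gam)) (fun u => (opB v *m T u 1 1) s t)
    (fun u => (opB v *m opA u) s t)
    (fun u => wa gam (2 * u + gam)) (fun u => (opB u *m T v 1 1) s t)
    (fun u => (opB u *m opA v) s t)).
(* The difference is multiplied by b(u+v), b(u-v) and a(u+v) in turn. Where one of them vanishes the
   product is zero anyway; elsewhere [exchange_DB_generic] applies. *)
apply: (wb_shift_mul_eq0 v _ tF).
apply: (wb_shift_mul_eq0 (- v) _ (trigM _ _ (tb _) tF)).
apply: (wb_shift_mul_eq0 (v + gam) _ (trigM _ _ (tb _) (trigM _ _ (tb _) tF))) => u.
have [->|ap] := eqVneq (wb (u + (v + gam))) 0; first by rewrite mul0r.
have [->|bm] := eqVneq (wb (u - v)) 0; first by rewrite mul0r mulr0.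
have [->|bp] := eqVneq (wb (u + v)) 0; first by rewrite mul0r !mulr0.
rewrite (exchange_DB_generic _ _ ((opA u *m opB v) s t) ((T u 1 1 *m opB v) s t)
  ((opB v *m T u 1 1) s t) ((opB u *m T v 1 1) s t) ((opB v *m opA u) s t)
  ((opB u *m opA v) s t) ((opA v *m opB u) s t)) ?subrr ?mulr0 //.
- by rewrite wbB oppr_eq0.
- by rewrite /wa -addrA.
- exact: exchange_AB_entry.
- by rewrite [u + v]addrC; exact: exchange_AB_entry.
- have := congr1 (fun X : 'M[C]_N => X s t) (reflection_DB _ _ _ RE u v).
  by rewrite /= !mx_linE.
Qed.

Lemma mx_lin3E c1 c2 c3 (X Y Z : 'M[C]_N) s t :
  (c1 *: X + c2 *: Y + c3 *: Z) s t = c1 * X s t + c2 * Y s t + c3 * Z s t.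
Proof. by rewrite !mx_linE. Qed.

Lemma mul_opD (X : 'M[C]_N) v s t :
  (X *m opD v) s t = (X *m T v 1 1) s t - Csinh gam / wa gam (2 * v) * (X *m opA v) s t.
Proof. by rewrite [opDt]unlock mulmxBr -scalemxAr mxDE mxNE mxZE. Qed.

Lemma opD_mul (X : 'M[C]_N) v s t :
  (opD v *m X) s t = (T v 1 1 *m X) s t - Csinh gam / wa gam (2 * v) * (opA v *m X) s t.
Proof. by rewrite [opDt]unlock mulmxBl -scalemxAl mxDE mxNE mxZE. Qed.

Lemma exchange_DB u v : wb (u - v) != 0 -> wa gam (u + v) != 0 -> wa gam (2 * u) != 0 ->
  wa gam (2 * v) != 0 ->
  opD u *m opB v = coef_f' u v *: (opB v *m opD u) + coef_g' u v *: (opB u *m opD v)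
    + coef_k' u v *: (opB u *m opA v).
Proof.
move=> bm ap a2u a2v; apply/matrixP => s t.
rewrite mx_lin3E (opD_mul (opB v) u s t) (mul_opD (opB v) u s t) (mul_opD (opB u) v s t).
have := exchange_DB_cleared u v s t.
move: ((opB v *m opA u) s t) ((opA u *m opB v) s t) ((opB u *m T v 1 1) s t)
  ((opB u *m opA v) s t)
  ((opB v *m T u 1 1) s t) ((T u 1 1 *m opB v) s t) => z1 x0 y2 z2 y1 y0 E.
have E' : y0 - Csinh gam / wa gam (2 * u) * x0 = wb (u - v) * wa gam (u + v) * wa gam (2 * v) *
    (wa gam (2 * u) * y0 - Csinh gam * x0) / (wb (u - v) * wa gam (u + v) * wa gam (2 * v)
    * wa gam (2 * u)).
  by field; rewrite bm ap a2u a2v.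
have ap' : wb (u + v + gam) = wa gam (u + v) by [].
rewrite E' E /coef_f' /coef_g' /coef_k' ap'.
by field; rewrite bm ap a2u a2v.
Qed.

End Exchange.

Ltac sinh_field := rewrite /wa /wb /Csinh !CexpE; field; rewrite !Cexp_neq0.

(* These identities recombine the coefficients of the terms containing B(u) B(v) in the
   inductive step of [off_shell_bethe]. *)
Section Coef.
Variables (gam u v w : C).
Notation a := (wa gam).
Notation b := wb.
Notation c := (Csinh gam).
Hypotheses (buv : b (u - v) != 0) (buw : b (u - w) != 0) (bvw : b (v - w) != 0).
Hypotheses (auv : a (u + v) != 0) (auw : a (u + w) != 0) (avw : a (v + w) != 0).
Hypotheses (auu : a (2 * u) != 0) (avv : a (2 * v) != 0) (aww : a (2 * w) != 0).

Let swaps :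
  (((b (v - u) = - b (u - v))%R * (b (w - u) = - b (u - w))%R * (b (w - v) = - b (v - w))%R) *
  ((v + u = u + v)%R * (w + u = u + w)%R * (w + v = v + w)%R))%type.
Proof. exact: (wbB v u, wbB w u, wbB w v, (addrC v u, addrC w u, addrC w v)). Qed.

Let nz := (buv, buw, bvw, auv, auw, avw, auu, avv, aww).

Lemma coef_fg :
  coef_f gam u v * coef_g gam u w + coef_g gam u v * coef_g gam v w
  + coef_k gam u v * coef_k' gam v w
  = coef_g gam u w * coef_f gam w v.
Proof.
(* [E] is the numerator over the common denominator. Exponentials are expanded only here; the later
   [field] calls treat the values of [a] and [b] as atoms. The next three lemmas follow the same
   pattern. *)
have E : a (v - u) * b (u + v) * a (2 * v) * b (v - w) * a (v + w)
   - b (2 * v) * c * a (u + v) * b (u - w) * a (v + w)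
   + c * a (2 * v + gam) * b (u - v) * b (u - w) * b (v - w)
   = - (a (v - w) * b (v + w) * b (u - v) * a (u + v) * a (2 * v)).
  by sinh_field.
rewrite /coef_f /coef_g /coef_k /coef_k' !swaps.
transitivity (- c * b (2 * w) * (a (v - u) * b (u + v) * a (2 * v) * b (v - w) * a (v + w)
   - b (2 * v) * c * a (u + v) * b (u - w) * a (v + w)
   + c * a (2 * v + gam) * b (u - v) * b (u - w) * b (v - w))
   / (b (u - v) * a (u + v) * a (2 * w) * b (u - w) * a (2 * v) * b (v - w) * a (v + w))).
  by field; rewrite !nz.
by rewrite E; field; rewrite !nz.
Qed.

Lemma coef_fk :
  coef_f gam u v * coef_k gam u w + coef_g gam u v * coef_k gam v w
  + coef_k gam u v * coef_g' gam v w
  = coef_k gam u w * coef_f' gam w v.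
Proof.
have E : a (v - u) * b (u + v) * a (2 * v) * a (v + w) * b (v - w)
   - b (2 * v) * c * a (u + v) * a (u + w) * b (v - w)
   + c * a (2 * v + gam) * b (u - v) * a (u + w) * a (v + w)
   = a (w - v) * a (v + w + gam) * b (u - v) * a (u + v) * a (2 * v).
  by sinh_field.
rewrite /coef_f /coef_g /coef_k /coef_f' /coef_g' -[b (_ + gam)]/(a _) !swaps.
transitivity (c * (a (v - u) * b (u + v) * a (2 * v) * a (v + w) * b (v - w)
   - b (2 * v) * c * a (u + v) * a (u + w) * b (v - w)
   + c * a (2 * v + gam) * b (u - v) * a (u + w) * a (v + w))
   / (b (u - v) * a (u + v) * a (u + w) * a (2 * v) * a (v + w) * b (v - w))).
  by field; rewrite !nz.
by rewrite E; field; rewrite !nz.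
Qed.

Lemma coef_fg' :
  coef_f' gam u v * coef_g' gam u w + coef_g' gam u v * coef_g' gam v w
  + coef_k' gam u v * coef_k gam v w
  = coef_g' gam u w * coef_f' gam w v.
Proof.
have E : - a (u - v) * a (u + v + gam) * b (v - w) * a (2 * v) * a (v + w)
   + c * a (2 * v + gam) * a (u + v) * b (u - w) * a (v + w)
   - c * b (2 * v) * b (u - v) * b (u - w) * b (v - w)
   = a (w - v) * a (v + w + gam) * b (u - v) * a (u + v) * a (2 * v).
  by sinh_field.
rewrite /coef_k /coef_k' /coef_f' /coef_g' -![b (_ + gam)]/(a _) !swaps.
transitivity (c * a (2 * u + gam) * 
    (- a (u - v) * a (u + v + gam) * b (v - w) * a (2 * v) * a (v + w)
   + c * a (2 * v + gam) * a (u + v) * b (u - w) * a (v + w)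
   - c * b (2 * v) * b (u - v) * b (u - w) * b (v - w))
   / (b (u - v) * a (u + v) * b (u - w) * a (2 * u) * b (v - w) * a (2 * v) * a (v + w))).
  by field; rewrite !nz.
by rewrite E; field; rewrite !nz.
Qed.

Lemma coef_fk' :
  coef_f' gam u v * coef_k' gam u w + coef_g' gam u v * coef_k' gam v w
  + coef_k' gam u v * coef_g gam v w
  = coef_k' gam u w * coef_f gam w v.
Proof.
have E : a (u - v) * a (u + v + gam) * a (v + w) * a (2 * v) * b (v - w)
   - c * a (2 * v + gam) * a (u + v) * a (u + w) * b (v - w)
   + c * b (2 * v) * b (u - v) * a (u + w) * a (v + w)
   = a (v - w) * b (v + w) * b (u - v) * a (u + v) * a (2 * v).
  by sinh_field.
rewrite /coef_f /coef_g /coef_k' /coef_f' /coef_g' -[b (_ + gam)]/(a _) !swaps.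
transitivity (c * b (2 * w) * a (2 * u + gam) *
    (a (u - v) * a (u + v + gam) * a (v + w) * a (2 * v) * b (v - w)
   - c * a (2 * v + gam) * a (u + v) * a (u + w) * b (v - w)
   + c * b (2 * v) * b (u - v) * a (u + w) * a (v + w))
   / (b (u - v) * a (u + v) * a (u + w) * a (2 * u) * a (2 * w) * a (v + w) * a (2 * v) *
      b (v - w))).
  by field; rewrite !nz.
by rewrite E; field; rewrite !nz.
Qed.

End Coef.

Lemma addr_shuffle (V : zmodType) (x y z s1 s2 s3 : V) :
  x + s1 + (y + s2) + (z + s3) = x + (y + z + (s1 + s2 + s3)).
Proof. by rewrite (addrACA x) (addrACA (x + y)) -(addrA x) -(addrA x). Qed.

(** Stated for an abstract [Xu] so that it serves both A and D~. The term with [Bv] itself replaced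
    by [Bu] is new; the older unwanted terms arise three times, and commutativity of the B operators
    brings them to one vector so that their coefficients add to [t i]. *)
Lemma bethe_step N (r : seq nat) (Bu Bv Xu Av Dv : 'M[C]_N) (w : 'cV[C]_N) (wi : nat -> 'cV[C]_N)
    (phi al be x y z : C) (c d e t : nat -> C) :
  Xu *m Bv = phi *: (Bv *m Xu) + al *: (Bu *m Av) + be *: (Bu *m Dv) -> Bv *m Bu = Bu *m Bv ->
  Xu *m w = x *: w + \sum_(i <- r) c i *: (Bu *m wi i) ->
  Av *m w = y *: w + \sum_(i <- r) d i *: (Bv *m wi i) ->
  Dv *m w = z *: w + \sum_(i <- r) e i *: (Bv *m wi i) ->
  {in r, forall i, phi * c i + al * d i + be * e i = t i} ->
  Xu *m (Bv *m w) = (phi * x) *: (Bv *m w) +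
    ((al * y + be * z) *: (Bu *m w) + \sum_(i <- r) t i *: (Bu *m (Bv *m wi i))).
Proof.
move=> EX BC Ex Ey Ez Et.
rewrite mulmxA EX !mulmxDl -!scalemxAl -!mulmxA Ex Ey Ez !mulmxDr !mulmx_sumr !scalerDr.
rewrite -!scalemxAr !scalerA scalerDl.
have -> : \sum_(i <- r) t i *: (Bu *m (Bv *m wi i)) =
   phi *: (\sum_(i <- r) Bv *m (c i *: (Bu *m wi i)))
   + al *: (\sum_(i <- r) Bu *m (d i *: (Bv *m wi i)))
   + be *: (\sum_(i <- r) Bu *m (e i *: (Bv *m wi i))).
  rewrite !scaler_sumr -!big_split big_seq [RHS]big_seq; apply: eq_bigr => i /Et <- /=.
  rewrite -!scalemxAr !scalerA [Bv *m (Bu *m _)]mulmxA BC -mulmxA !scalerDl; reflexivity.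
exact: addr_shuffle.
Qed.

(** * Off-shell Bethe vectors *)

Section Bethe.
Variables (gam : C) (N : nat) (opA opB opD : C -> 'M[C]_N) (vac : 'cV[C]_N) (LA LD : C -> C)
  (lam : nat -> C).
Hypothesis exAB : forall u v, wb (u - v) != 0 -> wa gam (u + v) != 0 -> wa gam (2 * v) != 0 ->
  opA u *m opB v = coef_f gam u v *: (opB v *m opA u) + coef_g gam u v *: (opB u *m opA v)
    + coef_k gam u v *: (opB u *m opD v).
Hypothesis exDB : forall u v, wb (u - v) != 0 -> wa gam (u + v) != 0 -> wa gam (2 * u) != 0 ->
  wa gam (2 * v) != 0 ->
  opD u *m opB v = coef_f' gam u v *: (opB v *m opD u) + coef_k' gam u v *: (opB u *m opA v)
    + coef_g' gam u v *: (opB u *m opD v).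
Hypothesis BC : forall u v, opB u *m opB v = opB v *m opB u.
Hypothesis vacA : forall u, wa gam (2 * u) != 0 -> opA u *m vac = LA u *: vac.
Hypothesis vacD : forall u, wa gam (2 * u) != 0 -> opD u *m vac = LD u *: vac.

Definition bethe_vector (r : seq nat) : 'cV[C]_N := foldr (fun i x => opB (lam i) *m x) vac r.
Definition weightA r i := LA (lam i) * \prod_(j <- r | j != i) coef_f gam (lam i) (lam j).
Definition weightD r i := LD (lam i) * \prod_(j <- r | j != i) coef_f' gam (lam i) (lam j).

(** Both formulas are proved together and for every [u]: moving A or D~ past the first B leaves A
    and D~ at [lam m], so the induction hypothesis is needed at [u] and at [lam m]. *)
Lemma off_shell_bethe r u : uniq r ->
  {in r &, forall i j, i != j -> wb (lam i - lam j) != 0 /\ wa gam (lam i + lam j) != 0} ->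
  {in r, forall i, wa gam (2 * lam i) != 0} ->
  {in r, forall i, wb (u - lam i) != 0 /\ wa gam (u + lam i) != 0} -> wa gam (2 * u) != 0 ->
  opA u *m bethe_vector r = (LA u * \prod_(j <- r) coef_f gam u (lam j)) *: bethe_vector r
    + \sum_(i <- r) (coef_g gam u (lam i) * weightA r i + coef_k gam u (lam i) * weightD r i) *:
       (opB u *m bethe_vector [seq j <- r | j != i]) /\
  opD u *m bethe_vector r = (LD u * \prod_(j <- r) coef_f' gam u (lam j)) *: bethe_vector r
    + \sum_(i <- r) (coef_k' gam u (lam i) * weightA r i + coef_g' gam u (lam i) * weightD r i) *:
       (opB u *m bethe_vector [seq j <- r | j != i]).
Proof.
elim: r u => [|m r IH] u /=.
  by move=> _ _ _ _ a2u; rewrite !big_nil !addr0 !mulr1 vacA // vacD.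
move=> /andP[mr ur] sep sep2 sepu a2u.
have rin i : i \in r -> i \in m :: r by rewrite inE orbC => ->.
have min : m \in m :: r by rewrite inE eqxx.
have mi i : i \in r -> m != i by apply: contraTneq => <-.
have sepr : {in r &, forall i j, i != j -> 
    wb (lam i - lam j) != 0 /\ wa gam (lam i + lam j) != 0}.
  by move=> i j /rin ir /rin jr; apply: sep.
have sepr2 : {in r, forall i, wa gam (2 * lam i) != 0} by move=> i /rin; apply: sep2.
have [b_um a_um] := sepu m min.
have [Au Du] := IH u ur sepr sepr2 (fun i ir => sepu i (rin i ir)) a2u.
have [||Am Dm] := IH (lam m) ur sepr sepr2; last 1 first.
- have wAm : weightA (m :: r) m = LA (lam m) * \prod_(j <- r) coef_f gam (lam m) (lam j).
    rewrite /weightA big_cons eqxx big_seq_cond [in RHS]big_seq; congr (_ * _);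
      apply: eq_bigl => j.
    by case: (boolP (j \in r)) => //= /mi; rewrite eq_sym => ->.
  have wDm : weightD (m :: r) m = LD (lam m) * \prod_(j <- r) coef_f' gam (lam m) (lam j).
    rewrite /weightD big_cons eqxx big_seq_cond [in RHS]big_seq; congr (_ * _);
      apply: eq_bigl => j.
    by case: (boolP (j \in r)) => //= /mi; rewrite eq_sym => ->.
  have wA i : i \in r -> weightA (m :: r) i = coef_f gam (lam i) (lam m) * weightA r i.
    by move=> /mi nmi; rewrite /weightA big_cons nmi mulrCA.
  have wD i : i \in r -> weightD (m :: r) i = coef_f' gam (lam i) (lam m) * weightD r i.
    by move=> /mi nmi; rewrite /weightD big_cons nmi mulrCA.
  have fm : [seq j <- r | j != m] = r.
    by apply/all_filterP/allP => j /mi; rewrite eq_sym.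
  have fi i : i \in r -> (if m != i then m :: [seq j <- r | j != i] else [seq j <- r | j != i])
      = m :: [seq j <- r | j != i].
    by move=> /mi ->.
  have a2m := sep2 m min.
  split.
  + rewrite (bethe_step _ r _ _ _ _ _ _ _ _ _ _ _ _ _ _ _ _
      (fun i => coef_g gam u (lam i) * weightA (m :: r) i
        + coef_k gam u (lam i) * weightD (m :: r) i)
      (exAB _ _ b_um a_um a2m) (BC _ _) Au Am Dm); last first.
      move=> i ir; rewrite wA // wD //.
      have [b_ui a_ui] := sepu i (rin i ir); have a2i := sep2 i (rin i ir).
      have [b_mi a_mi] := sep m i min (rin i ir) (mi i ir).
      move: (weightA r i) (weightD r i) => P Q /=.
      rewrite (mulrA (coef_g gam u (lam i))) -(coef_fg gam u (lam m) (lam i)) //.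
      rewrite (mulrA (coef_k gam u (lam i))) -(coef_fk gam u (lam m) (lam i)) //.
      ring.
    rewrite !big_cons eqxx fm wAm wDm mulrCA; congr (_ + (_ + _)).
    by rewrite big_seq [RHS]big_seq; apply: eq_bigr => i ir; rewrite fi.
  + rewrite (bethe_step _ r _ _ _ _ _ _ _ _ _ _ _ _ _ _ _ _
      (fun i => coef_k' gam u (lam i) * weightA (m :: r) i
        + coef_g' gam u (lam i) * weightD (m :: r) i)
      (exDB _ _ b_um a_um a2u a2m) (BC _ _) Du Am Dm); last first.
      move=> i ir; rewrite wA // wD //.
      have [b_ui a_ui] := sepu i (rin i ir); have a2i := sep2 i (rin i ir).
      have [b_mi a_mi] := sep m i min (rin i ir) (mi i ir).
      move: (weightA r i) (weightD r i) => P Q /=.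
      rewrite (mulrA (coef_k' gam u (lam i))) -(coef_fk' gam u (lam m) (lam i)) //.
      rewrite (mulrA (coef_g' gam u (lam i))) -(coef_fg' gam u (lam m) (lam i)) //.
      ring.
    rewrite !big_cons eqxx fm wAm wDm mulrCA; congr (_ + (_ + _)).
    by rewrite big_seq [RHS]big_seq; apply: eq_bigr => i ir; rewrite fi.
- by move=> i ir; apply: sep => //; [exact: rin|exact: mi].
- exact: sep2.
Qed.

End Bethe.

(** * The lattice *)

Section Sites.
Variable L : nat.
Notation N := #|{ffun 'I_L -> 'I_2}|.

(** Numbering the spin configurations makes the ring of matrices available for operators given as
    functions. *)
Definition mxop (q : qop L) : 'M[C]_N := \matrix_(i, j) q (enum_val i) (enum_val j).

Lemma sum_spin (V : nmodType) (F : spin L -> V) :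
  \sum_(s : spin L) F s = \sum_(i < N) F (enum_val i).
Proof.
rewrite (reindex (fun i : 'I_N => enum_val i : spin L)) //.
by apply: onW_bij; exact: enum_val_bij.
Qed.

Lemma mxop_mul a b : mxop (qmul a b) = mxop a *m mxop b.
Proof.
apply/matrixP => i j; rewrite !mxE /qmul sum_spin.
by apply: eq_bigr => k _; rewrite !mxE.
Qed.

Lemma mxop_id : mxop qid = 1%:M.
Proof. by apply/matrixP => i j; rewrite !mxE /qid (inj_eq enum_val_inj); case: eqP. Qed.

Definition blk (X : op L) : 'M['M[C]_N]_2 := \matrix_(i, j) mxop (fun s t => X (i, s) (j, t)).

Lemma blk_mul X Y : blk (opmul X Y) = blk X * blk Y.
Proof.
apply/matrixP => i j; rewrite !mxE; apply/matrixP => s t; rewrite summxE mxE /opmul.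
rewrite (eq_bigr (fun z => X (i, enum_val s) (z.1, z.2) * Y (z.1, z.2) (j, enum_val t)));
  last by case.
rewrite -(pair_bigA _ (fun a b => X (i, enum_val s) (a, b) * Y (a, b) (j, enum_val t))) /=.
by apply: eq_bigr => k _; rewrite sum_spin !mxE; apply: eq_bigr => u _; rewrite !mxE.
Qed.

Lemma blk_id : blk opid = 1.
Proof.
apply/matrixP => i j; rewrite !mxE; apply/matrixP => s t;
  rewrite !mxE /opid xpair_eqE (inj_eq enum_val_inj).
by case: (i == j); rewrite /= ?mxE //; case: eqP.
Qed.

Definition agree_off (k : 'I_L) (s t : spin L) : bool := [forall l, (l != k) ==> (s l == t l)].

Definition siteq (k : 'I_L) (M : 'M[C]_2) : qop L :=
  fun s t => M (s k) (t k) * (agree_off k s t)%:R.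
End Sites.

Arguments mxop {L}. Arguments blk {L}. Arguments agree_off {L}. Arguments siteq {L}.
HB.lock Definition site L (k : 'I_L) (M : 'M[C]_2) : 'M[C]_#|{ffun 'I_L -> 'I_2}| :=
  mxop (siteq k M).
Arguments site {L}.

Section Site_theory.
Variable L : nat.
Notation N := #|{ffun 'I_L -> 'I_2}|.
Implicit Types (k : 'I_L) (M : 'M[C]_2) (s t : spin L).

Lemma siteE k M i j :
  site k M i j = M ((enum_val i : spin L) k) ((enum_val j : spin L) k)
    * (agree_off k (enum_val i) (enum_val j))%:R.
Proof. by rewrite [@site]unlock mxE. Qed.

Lemma site_linear k : linear (site k).
Proof.
by move=> c M M'; apply/matrixP => i j; rewrite mxDE mxZE !siteE mxDE mxZE mulrDl mulrA.
Qed.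

HB.instance Definition _ k := GRing.isLinear.Build C 'M[C]_2 'M[C]_N _ (site k) (site_linear k).

Definition upd k (c : 'I_2) (s : spin L) : spin L := [ffun l => if l == k then c else s l].

Lemma agree_offP k s t : reflect (forall l, l != k -> s l = t l) (agree_off k s t).
Proof.
apply: (iffP forallP) => H l; last by apply/implyP => /H ->.
by move=> lk; have /implyP/(_ lk)/eqP := H l.
Qed.

Lemma agree_off_upd k s t : agree_off k s t -> t = upd k (t k) s.
Proof.
move=> /agree_offP H; apply/ffunP => l; rewrite ffunE; case: eqP => [->//|/eqP /H //].
Qed.

Lemma agree_off_updl k c s t : agree_off k (upd k c s) t = agree_off k s t.
Proof.
by apply/agree_offP/agree_offP => H l lk; rewrite -H // ffunE (negPf lk).
Qed.

Lemma agree_off_updr k c s : agree_off k s (upd k c s).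
Proof. by apply/agree_offP => l lk; rewrite ffunE (negPf lk). Qed.

Lemma sum_agree_off (V : pzRingType) k s (F : spin L -> V) :
  \sum_(u : spin L) F u * (agree_off k s u)%:R = \sum_(c < 2) F (upd k c s).
Proof.
rewrite (partition_big (fun u : spin L => u k) predT) //=; apply: eq_bigr => c _.
rewrite (bigD1 (upd k c s)) /=; last by rewrite ffunE eqxx.
rewrite agree_off_updr mulr1 big1 ?addr0 // => u /andP[/eqP uk uneq].
case: (boolP (agree_off _ _ _)) => [/agree_off_upd|]; last by rewrite mulr0.
by rewrite uk => u_eq; rewrite u_eq eqxx in uneq.
Qed.

Lemma siteM k M M' : site k (M *m M') = site k M *m site k M'.
Proof.
apply/matrixP => i j; rewrite siteE [RHS]mxE.
under eq_bigr do rewrite !siteE mulrAC.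
rewrite -(sum_spin _ _ (fun u : spin L => M ((enum_val i : spin L) k) (u k) *
  (M' (u k) ((enum_val j : spin L) k) * (agree_off k u (enum_val j))%:R)
  * (agree_off k (enum_val i) u)%:R)).
rewrite sum_agree_off mxE mulr_suml; apply: eq_bigr => c _.
by rewrite agree_off_updl ffunE eqxx mulrA.
Qed.

Lemma site_comm k k' M M' : k != k' -> site k M *m site k' M' = site k' M' *m site k M.
Proof.
(* [F] is the entry of either product; it is unchanged when the two sites are exchanged together
   with their matrices. *)
move=> kk'; pose F (k k' : 'I_L) (M M' : 'M[C]_2) (s t : spin L) :=
  M (s k) (t k) * M' (s k') (t k') *
  [forall l, (l != k) ==> (l != k') ==> (s l == t l)]%:R.
have E k1 k2 M1 M2 i j : k1 != k2 -> (site k1 M1 *m site k2 M2) i j =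
  F k1 k2 M1 M2 (enum_val i) (enum_val j).
  move=> k12; rewrite mxE; under eq_bigr do rewrite !siteE mulrAC.
  set s := enum_val i; set t := enum_val j.
  rewrite -(sum_spin _ _ (fun u : spin L => M1 (s k1) (u k1) *
    (M2 (u k2) (t k2) * (agree_off k2 u t)%:R) * (agree_off k1 s u)%:R)).
  (* The second operator leaves site [k1] alone, so the intermediate spin there must already be
     [t k1]. *)
  rewrite sum_agree_off (bigD1 (t k1)) //= big1 ?addr0 => [|c nc].
    rewrite !ffunE eqxx eq_sym (negPf k12) mulrA /F; congr (_ * _%:R).
    congr nat_of_bool; apply/agree_offP/forallP => H l.
      apply/implyP => l1; apply/implyP => l2; rewrite -H // ffunE (negPf l1) //.
    move=> l2; rewrite ffunE; case: eqP => [->//|/eqP l1].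
    by apply/eqP; move: (H l); rewrite l1 l2.
  have [/agree_offP /(_ k1 k12)|_] := boolP (agree_off k2 (upd k1 c s) t); last by rewrite !mulr0.
  by rewrite ffunE eqxx => ct; rewrite ct eqxx in nc.
apply/matrixP => i j; rewrite !E ?[k' == k]eq_sym // /F [in RHS]mulrC.
rewrite [RHS]mulrC [M' _ _ * _]mulrC; congr (_ * _%:R); congr nat_of_bool.
by apply: eq_forallb => l; case: (l == k); case: (l == k').
Qed.

End Site_theory.

(** * The double-row monodromy matrix as iterated dressing *)

Section Monodromy.
Variables (L : nat) (gam h : C) (mu : nat -> C).
Notation N := #|{ffun 'I_L -> 'I_2}|.

Lemma blk_R0j w (j : 'I_L) : blk (R0j gam w j) = lax (site j) gam w.
Proof.
apply/matrixP => a b; rewrite laxE mxE; apply/matrixP => s t.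
by rewrite siteE !mxE /R0j /= -/(agree_off j _ _); case: agree_off.
Qed.

Lemma blk_Kop w : blk (Kop L h w) = kmx N h w.
Proof.
apply/matrixP => a b; rewrite kmxE mxE; apply/matrixP => s t.
rewrite !mxE /Kop xpair_eqE (inj_eq enum_val_inj) /=.
by case: (a == b); case: (s == t); rewrite /= ?mulr0n ?mulr1n ?mul0rn.
Qed.

(** Nested from the centre K outwards, the head of [r] being the outermost site; the full operator
    therefore belongs to the reversed enumeration of the sites. *)
Definition monodromy (r : seq 'I_L) w : 'M['M[C]_N]_2 :=
  foldr (fun j X => lax (site j) gam (w - mu j.+1) * X * lax (site j) gam (w + mu j.+1))
  (kmx N h w) r.

Lemma blk_Tmon w : blk (Tmon L gam mu h w) = monodromy (rev (enum 'I_L)) w.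
Proof.
rewrite /Tmon !blk_mul blk_Kop /tau /taubar -{2}[enum 'I_L]revK.
elim: (rev (enum 'I_L)) => [|j r IH] /=; first by rewrite blk_id mul1r mulr1.
(* The outermost site is the last factor of [taubar], at the far end of its [foldr]; factoring out
   the initial value allows it to be peeled off. *)
have foldr_blk (s : seq 'I_L) (X : op L) :
    blk (foldr (fun (j : 'I_L) acc => opmul (R0j gam (w + mu j.+1) j) acc) X s) =
    blk (foldr (fun (j : 'I_L) acc => opmul (R0j gam (w + mu j.+1) j) acc) opid s) * blk X.
  elim: s => [|i s IHs] /=; first by rewrite blk_id mul1r.
  by rewrite !blk_mul IHs mulrA.
rewrite rev_cons foldr_rcons foldr_blk !blk_mul blk_id mulr1 !blk_R0j -IH.
by rewrite !mulrA.
Qed.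

Definition commutes (Y : 'M[C]_N) (P : 'M['M[C]_N]_2) := forall a b, Y *m P a b = P a b *m Y.

Lemma commutes_mul Y P Q : commutes Y P -> commutes Y Q -> commutes Y (P * Q).
Proof.
move=> cP cQ a b; rewrite mxE mulmx_sumr mulmx_suml; apply: eq_bigr => k _.
by rewrite [P a k * _]/(P a k *m _) mulmxA cP -mulmxA cQ mulmxA.
Qed.

Lemma commutes_monodromy (j : 'I_L) X r w : j \notin r -> commutes (site j X) (monodromy r w).
Proof.
elim: r => [_|i r IH] /=; first by move=> a b; rewrite kmxE scalar_mxC.
rewrite inE negb_or => /andP[ji jr].
by apply: commutes_mul; [apply: commutes_mul; [|exact: IH]|] => a b; rewrite laxE site_comm.
Qed.

Lemma reflection_equation_monodromy r : uniq r -> reflection_equation gam N (monodromy r).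
Proof.
elim: r => [_|j r IH /= /andP[jr ur]]; first exact: reflection_equation_kmx.
apply: (reflection_equation_dress gam N (site j : {linear _ -> _})
  (mu j.+1) (monodromy r) (siteM L j) _ (IH ur)).
by move=> w a b X; apply: commutes_monodromy.
Qed.

Definition trigm (F : C -> 'M['M[C]_N]_2) := forall a b s t, trig (fun u => F u a b s t).

Lemma trigm_mul F G : trigm F -> trigm G -> trigm (fun u => F u * G u).
Proof.
move=> tF tG a b s t; apply: trig_eq (trig_sum _ (fun k u => (F u a k *m G u k b) s t) _).
  by move=> u; rewrite mxE summxE.
by move=> k; apply: trig_mulmx.
Qed.

Lemma trigm_lax (j : 'I_L) c : trigm (fun u => lax (site j) gam (u + c)).
Proof.
move=> a b s t.
have tR x y : trig (fun u => Rmat gam (u + c) x y).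
  case: x y => [x1 x2] [y1 y2]; rewrite /Rmat.
  case: (_ == _); case: (_ && _); try exact: trig_cst.
  - by apply: trig_eq (trig_sinhDr (c + gam)) => u; rewrite /wa addrA.
  - exact: trig_sinhDr.
  - by case: (_ && _); exact: trig_cst.
apply: trig_eq (trigM _ _ (tR (a, (enum_val s : spin L) j) (b, (enum_val t : spin L) j))
  (trig_cst (agree_off j (enum_val s) (enum_val t))%:R)).
by move=> u; rewrite laxE siteE mxE.
Qed.

Lemma trigm_monodromy r : trigm (monodromy r).
Proof.
elim: r => [|j r IH] /=; last first.
  by apply: trigm_mul; [apply: trigm_mul|]; [apply: trigm_lax|exact: IH|apply: trigm_lax].
move=> a b s t.
apply: (trig_eq _ (fun u => (if a == 0 then Csinh (u + h) else Csinh (h - u))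
  * ((a == b) && (s == t))%:R)).
  by move=> u; rewrite kmxE mxE [u + h]addrC; case: (a == b); case: (s == t);
    rewrite /= ?(mulr0, mulr1, mul0rn).
apply: trigM (trig_cst _); case: (a == 0); [exact: trig_sinhDr|exact: trig_sinhB].
Qed.

End Monodromy.

(** * Reference states *)

(** Here [x] and [z] are the factors of a new site around the inner matrix [y]. Entries of [y]
    commute past the site and reach [v], so every term with a lower left entry dies except
    [x10 y00 z01], where the site is raised and lowered again. It mixes the A eigenvalue [al] into
    that of D. *)
Lemma dressed_vac N (x00 x01 x10 x11 y00 y01 y10 y11 z00 z01 z10 z11 : 'M[C]_N) (v : 'cV[C]_N)
  (a a' b b' c al de : C) :
  x00 *m v = a *: v -> x10 *m v = 0 -> x11 *m v = b *: v ->
  z00 *m v = a' *: v -> z10 *m v = 0 -> z11 *m v = b' *: v -> x10 *m (z01 *m v) = c *: v ->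
  y00 *m v = al *: v -> y10 *m v = 0 -> y11 *m v = de *: v ->
  x10 *m y01 = y01 *m x10 -> z01 *m y00 = y00 *m z01 -> z01 *m y10 = y10 *m z01 ->
  [/\ (x00 *m y00 *m z00 + x01 *m y10 *m z00 + (x00 *m y01 *m z10 + x01 *m y11 *m z10)) *m v
      = (a * a' * al) *: v,
    (x10 *m y00 *m z00 + x11 *m y10 *m z00 + (x10 *m y01 *m z10 + x11 *m y11 *m z10)) *m v = 0 &
    (x10 *m y00 *m z01 + x11 *m y10 *m z01 + (x10 *m y01 *m z11 + x11 *m y11 *m z11)) *m v
      = (c * al + b * b' * de) *: v].
Proof.
move=> X0 X10 X1 Z0 Z10 Z1 XZ Y0 Y10 Y1 cx c0 c1.
have e0 : y00 *m (z01 *m v) = al *: (z01 *m v) by rewrite mulmxA -c0 -mulmxA Y0 scalemxAr.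
have e1 : y10 *m (z01 *m v) = 0 by rewrite mulmxA -c1 -mulmxA Y10 mulmx0.
have e2 : x10 *m (y01 *m v) = 0 by rewrite mulmxA cx -mulmxA X10 mulmx0.
rewrite !mulmxDl -!mulmxA Z0 Z10 Z1 e0 e1 !mulmx0 !addr0 -!scalemxAr Y0 Y10 Y1 XZ e2.
rewrite -!scalemxAr X0 X10 X1 !mulmx0 !scaler0 !addr0 !add0r !scalerA -scalerDl.
by split=> //; congr (_ *: _); ring.
Qed.

(** Mirror image of [dressed_vac]: the surviving extra term is [x01 y11 z10], so now A receives a
    multiple of the D eigenvalue. This is the origin of the two summands of [LamAbar]. *)
Lemma dressed_dual_vac N (x00 x01 x10 x11 y00 y01 y10 y11 z00 z01 z10 z11 : 'M[C]_N)
  (v : 'rV[C]_N) (a a' b b' c al de : C) :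
  v *m x00 = b *: v -> v *m x10 = 0 -> v *m x11 = a *: v ->
  v *m z00 = b' *: v -> v *m z10 = 0 -> v *m z11 = a' *: v -> v *m x01 *m z10 = c *: v ->
  v *m y00 = al *: v -> v *m y10 = 0 -> v *m y11 = de *: v ->
  z10 *m y01 = y01 *m z10 -> x01 *m y11 = y11 *m x01 -> x01 *m y10 = y10 *m x01 ->
  [/\ v *m (x10 *m y00 *m z01 + x11 *m y10 *m z01 + (x10 *m y01 *m z11 + x11 *m y11 *m z11))
      = (a * a' * de) *: v,
    v *m (x10 *m y00 *m z00 + x11 *m y10 *m z00 + (x10 *m y01 *m z10 + x11 *m y11 *m z10)) = 0 &
    v *m (x00 *m y00 *m z00 + x01 *m y10 *m z00 + (x00 *m y01 *m z10 + x01 *m y11 *m z10))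
      = (b * b' * al + c * de) *: v].
Proof.
move=> X0 X10 X1 Z0 Z10 Z1 XZ Y0 Y10 Y1 cz c1 c0.
have e1 : v *m x01 *m y11 = de *: (v *m x01) by rewrite -mulmxA c1 mulmxA Y1 scalemxAl.
have e0 : v *m x01 *m y10 = 0 by rewrite -mulmxA c0 mulmxA Y10 mul0mx.
have e2 : v *m y01 *m z10 = 0 by rewrite -mulmxA -cz mulmxA Z10 mul0mx.
rewrite !mulmxDr !mulmxA X0 X10 X1 e0 e1 !mul0mx -!scalemxAl Y0 Y10 Y1 XZ e2.
rewrite -!scalemxAl Z0 Z10 Z1 !mul0mx !scaler0 !add0r ?addr0 !scalerA -scalerDl.
by split=> //; congr (_ *: _); ring.
Qed.

Section Vacuum.
Variables (L : nat) (gam h : C) (mu : nat -> C).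
Notation N := #|{ffun 'I_L -> 'I_2}|.
Notation T := (monodromy L gam h mu).
Notation P j w a b := (lax (site j) gam w a b).

Definition vac : 'cV[C]_N := \col_i (enum_val i == [ffun=> 0] :> spin L)%:R.
Definition dual_vac : 'rV[C]_N := \row_i (enum_val i == [ffun=> 1] :> spin L)%:R.

Lemma eq_agree_off k (c : 'I_2) (s : spin L) :
  (s == [ffun=> c]) = (s k == c) && agree_off k s [ffun=> c].
Proof.
apply/eqP/andP => [->|[/eqP sk /agree_offP H]].
  by rewrite ffunE; split=> //; apply/agree_offP => l _.
by apply/ffunP => l; have [->|/H ->] := eqVneq l k; rewrite ?ffunE ?sk.
Qed.

Lemma site_vac k (M : 'M[C]_2) : M 1 0 = 0 -> site k M *m vac = M 0 0 *: vac.
Proof.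
move=> M10; apply/matrixP => i j; rewrite mxZE !mxE.
under eq_bigr do rewrite siteE mxE.
rewrite -(sum_spin _ _ (fun u : spin L => M ((enum_val i : spin L) k) (u k) *
  (agree_off k (enum_val i) u)%:R * (u == [ffun=> 0])%:R)).
rewrite (bigD1 [ffun=> 0]) //= eqxx mulr1 big1 ?addr0; last by move=> u /negPf ->; rewrite mulr0.
rewrite ffunE (eq_agree_off k).
by have [->|->] := ord2_cases ((enum_val i : spin L) k); rewrite ?M10 ?mul0r /= ?mulr0.
Qed.

Lemma agree_offC k (s t : spin L) : agree_off k s t = agree_off k t s.
Proof. by apply: eq_forallb => l; rewrite [s l == _]eq_sym. Qed.

Lemma dual_vac_site k (M : 'M[C]_2) : M 1 0 = 0 -> dual_vac *m site k M = M 1 1 *: dual_vac.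
Proof.
move=> M10; apply/matrixP => i j; rewrite mxZE !mxE.
under eq_bigr do rewrite siteE mxE.
rewrite -(sum_spin _ _ (fun u : spin L => (u == [ffun=> 1])%:R *
  (M (u k) ((enum_val j : spin L) k) * (agree_off k u (enum_val j))%:R))).
rewrite (bigD1 [ffun=> 1]) //= eqxx mul1r big1 ?addr0; last by move=> u /negPf ->; rewrite mul0r.
rewrite ffunE (eq_agree_off k) agree_offC.
by have [->|->] := ord2_cases ((enum_val j : spin L) k); rewrite ?M10 ?mul0r /= ?mulr0.
Qed.

Lemma lax_vac (j : 'I_L) w :
  [/\ P j w 0 0 *m vac = wa gam w *: vac, P j w 1 0 *m vac = 0 & P j w 1 1 *m vac = wb w *: vac].
Proof. by split; rewrite laxE site_vac !mxE //= scale0r. Qed.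

Lemma dual_vac_lax (j : 'I_L) w :
  [/\ dual_vac *m P j w 0 0 = wb w *: dual_vac, dual_vac *m P j w 1 0 = 0
    & dual_vac *m P j w 1 1 = wa gam w *: dual_vac].
Proof. by split; rewrite laxE dual_vac_site !mxE //= scale0r. Qed.

Lemma lax10_lax01_vac (j : 'I_L) w w' : P j w 1 0 *m (P j w' 0 1 *m vac) = Csinh gam ^+ 2 *: vac.
Proof. by rewrite !laxE mulmxA -siteM site_vac !mxE !sum_ord2 !mxE /= ?(mul0r, add0r, mulr0). Qed.

Lemma dual_vac_lax01_lax10 (j : 'I_L) w w' :
  dual_vac *m P j w 0 1 *m P j w' 1 0 = Csinh gam ^+ 2 *: dual_vac.
Proof.
by rewrite !laxE -mulmxA -siteM dual_vac_site !mxE !sum_ord2 !mxE /= ?(mul0r, addr0, mulr0).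
Qed.

Lemma mul3_entry (X Y Z : 'M['M[C]_N]_2) a b : (X * Y * Z) a b =
  X a 0 *m Y 0 0 *m Z 0 b + X a 1 *m Y 1 0 *m Z 0 b
  + (X a 0 *m Y 0 1 *m Z 1 b + X a 1 *m Y 1 1 *m Z 1 b).
Proof. by rewrite mxE sum_ord2 !mxE !sum_ord2 -!mulmxDl. Qed.

Definition prod_a w (r : seq 'I_L) :=
  \prod_(j <- r) (wa gam (w - mu j.+1) * wa gam (w + mu j.+1)).
Definition prod_b w (r : seq 'I_L) :=
  \prod_(j <- r) (wb (w - mu j.+1) * wb (w + mu j.+1)).

Lemma prod_a_cons w j r :
  prod_a w (j :: r) = wa gam (w - mu j.+1) * wa gam (w + mu j.+1) * prod_a w r.
Proof. exact: big_cons. Qed.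

Lemma prod_b_cons w j r : prod_b w (j :: r) = wb (w - mu j.+1) * wb (w + mu j.+1) * prod_b w r.
Proof. exact: big_cons. Qed.

(** Closes the recursion on sites: multiplied by c/a(2w), its last term is the c^2 contributed by
    the extra term of each dressing step. *)
Lemma wa_wb_mu w m : wa gam (w - m) * wa gam (w + m) =
  wb (w - m) * wb (w + m) + Csinh gam * wa gam (2 * w).
Proof. by sinh_field. Qed.

(** The D eigenvalue is split so that its first summand is exactly what [opDt] subtracts; the second
    becomes [LamDt]. *)
Lemma monodromy_vac r w : uniq r -> wa gam (2 * w) != 0 ->
  [/\ T r w 0 0 *m vac = (wb (h + w) * prod_a w r) *: vac, T r w 1 0 *m vac = 0
    & T r w 1 1 *m vac = (Csinh gam / wa gam (2 * w) * (wb (h + w) * prod_a w r)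
        - wb (2 * w) / wa gam (2 * w) * wa gam (w - h) * prod_b w r) *: vac].
Proof.
move=> + a2; elim: r => [_|j r IH /= /andP[jr ur]] /=.
  rewrite !kmxE /prod_a /prod_b !big_nil !mulr1 /= !mulr0n mulr1n raddf0 mul0mx mul_scalar_mx.
  split=> //; rewrite mul_scalar_mx; congr (_ *: _).
  apply: (mulfI a2); rewrite [RHS]mulrDr mulrN.
  have -> : wa gam (2 * w) * (Csinh gam / wa gam (2 * w) * wb (h + w)) =
    Csinh gam * wb (h + w) by field.
  have -> : wa gam (2 * w) * (wb (2 * w) / wa gam (2 * w) * wa gam (w - h)) =
    wb (2 * w) * wa gam (w - h) by field.
  by sinh_field.
have [T00 T10 T11] := IH ur.
have [A0 A10 A1] := lax_vac j (w + mu j.+1).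
have cT X := commutes_monodromy L gam h mu j X r w jr.
have cP w' a b a' b' : P j w' a b *m T r w a' b' = T r w a' b' *m P j w' a b by rewrite laxE cT.
have [B0 B10 B1] := lax_vac j (w - mu j.+1).
have [E0 E10 E1] := dressed_vac _ _ (P j (w - mu j.+1) 0 1) _ _ _ _ _ _ _ _ _ _ _ _ _ _ _ _ _ _
  B0 B10 B1 A0 A10 A1
  (lax10_lax01_vac j (w - mu j.+1) (w + mu j.+1)) T00 T10 T11 (cP _ 1 0 0 1) (cP _ 0 1 _ _)
  (cP _ 0 1 1 0).
have Ea := prod_a_cons w j r; have Eb := prod_b_cons w j r.
split; rewrite mul3_entry; [rewrite E0|exact: E10|rewrite E1]; congr (_ *: _);
  rewrite Ea ?Eb wa_wb_mu; first by ring.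
by field.
Qed.

Lemma dual_vac_monodromy r w : uniq r -> wa gam (2 * w) != 0 ->
  [/\ dual_vac *m T r w 1 1 = (wb (h - w) * prod_a w r) *: dual_vac, dual_vac *m T r w 1 0 = 0
    & dual_vac *m T r w 0 0 = (Csinh gam / wa gam (2 * w) * wb (h - w) * prod_a w r
        + wb (2 * w) / wa gam (2 * w) * wa gam (w + h) * prod_b w r) *: dual_vac].
Proof.
move=> + a2; elim: r => [_|j r IH /= /andP[jr ur]] /=.
  rewrite !kmxE /prod_a /prod_b !big_nil !mulr1 /= !mulr0n mulr1n raddf0 mulmx0 mul_mx_scalar.
  split=> //; rewrite mul_mx_scalar; congr (_ *: _).
  apply: (mulfI a2); rewrite [RHS]mulrDr.
  have -> : wa gam (2 * w) * (Csinh gam / wa gam (2 * w) * wb (h - w)) =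
    Csinh gam * wb (h - w) by field.
  have -> : wa gam (2 * w) * (wb (2 * w) / wa gam (2 * w) * wa gam (w + h)) =
    wb (2 * w) * wa gam (w + h) by field.
  by sinh_field.
have [T11 T10 T00] := IH ur.
have [A0 A10 A1] := dual_vac_lax j (w - mu j.+1).
have [B0 B10 B1] := dual_vac_lax j (w + mu j.+1).
have cT X := commutes_monodromy L gam h mu j X r w jr.
have cP w' a b a' b' : P j w' a b *m T r w a' b' = T r w a' b' *m P j w' a b by rewrite laxE cT.
have [E1 E10 E0] := dressed_dual_vac _ _ _ _ _ _ _ _ _ _ 
  (P j (w + mu j.+1) 0 1) _ _ _ _ _ _ _ _ _ _ A0 A10 A1 B0 B10 B1
  (dual_vac_lax01_lax10 j (w - mu j.+1) (w + mu j.+1)) T00 T10 T11 (cP _ 1 0 0 1)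
  (cP _ 0 1 _ _) (cP _ 0 1 1 0).
have Ea := prod_a_cons w j r; have Eb := prod_b_cons w j r.
split; rewrite mul3_entry; [rewrite E1|exact: E10|rewrite E0]; congr (_ *: _);
  rewrite Ea ?Eb wa_wb_mu; first by ring.
by field.
Qed.

End Vacuum.

Lemma wbB_neq0 u v : wb (u - v) != 0 -> wb (v - u) != 0.
Proof. by rewrite wbB oppr_eq0. Qed.

(** * The functional equation *)

Section Pairing.
Variable L : nat.
Notation N := #|{ffun 'I_L -> 'I_2}|.

Lemma mul_vacE m (X : 'M[C]_(m, N)) i : (X *m vac L) i 0 = X i (enum_rank ([ffun=> 0] : spin L)).
Proof.
rewrite mxE (bigD1 (enum_rank ([ffun=> 0] : spin L))) //= big1 ?addr0 => [|j nj].
  by rewrite mxE enum_rankK eqxx mulr1.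
rewrite mxE; case: eqP => [e|_]; last by rewrite mulr0.
by move: nj; rewrite -e enum_valK eqxx.
Qed.

Lemma dual_vac_mulE n (X : 'M[C]_(N, n)) j :
  (dual_vac L *m X) 0 j = X (enum_rank ([ffun=> 1] : spin L)) j.
Proof.
rewrite mxE (bigD1 (enum_rank ([ffun=> 1] : spin L))) //= big1 ?addr0 => [|i ni].
  by rewrite mxE enum_rankK eqxx mul1r.
rewrite mxE; case: eqP => [e|_]; last by rewrite mul0r.
by move: ni; rewrite -e enum_valK eqxx.
Qed.

End Pairing.

Lemma Zpf_bethe L gam mu h (opB : C -> 'M[C]_#|{ffun 'I_L -> 'I_2}|) lam r :
  (forall w, opB w = mxop (Bop L gam mu h w)) ->
  Zpf L gam mu h [seq lam j | j <- r] = (dual_vac L *m bethe_vector _ opB (vac L) lam r) 0 0.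
Proof.
move=> BE; rewrite /Zpf.
set q := foldr _ _ _; have <- : mxop q *m vac L = bethe_vector _ opB (vac L) lam r.
  rewrite {}/q; elim: r => [|i r IH] /=; first by rewrite mxop_id mul1mx.
  by rewrite mxop_mul -mulmxA IH BE.
by rewrite mulmxA mul_vacE dual_vac_mulE mxE !enum_rankK.
Qed.

(** Passes from sites numbered from 0 in ['I_L] to the parameter labels 1 to L; the order of the
    factors is immaterial. *)
Lemma prod_site_labels L (F : nat -> C) :
  \prod_(j <- rev (enum 'I_L)) F j.+1 = \prod_(1 <= j < L.+1) F j.
Proof.
by rewrite (perm_big (enum 'I_L)) ?perm_rev // big_enum /= big_add1 big_mkord.
Qed.

Theorem theorem1 (L : nat) (gam h : C) (mu lam : nat -> C) :
  (0 < L)%N ->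
  (forall i j : nat, (i <= L)%N -> (j <= L)%N -> i != j ->
     [/\ wb (lam i - lam j) != 0, wa gam (lam i + lam j) != 0
       & wb (lam i + lam j + gam) != 0]) ->
  (forall i : nat, (i <= L)%N -> wa gam (2 * lam i) != 0) ->
  M0 L gam mu h lam * Zpf L gam mu h [seq lam j | j <- iota 1 L]
  + \sum_(1 <= i < L.+1)
      Mi L gam mu h lam i *
      Zpf L gam mu h (lam 0%N :: [seq lam j | j <- iota 1 L & j != i])
  = 0.
Proof.
move=> _ sep sep2; pose s := rev (enum 'I_L); pose T := monodromy L gam h mu s.
have us : uniq s by rewrite rev_uniq enum_uniq.
have RE : reflection_equation gam _ T by apply: reflection_equation_monodromy.
have tT : forall i j a b, trig (fun u => T u i j a b) := trigm_monodromy L gam h mu s.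
pose r := iota 1 L.
have rL i : i \in r -> (i <= L)%N by rewrite mem_iota add1n ltnS => /andP[].
have r0 i : i \in r -> 0%N != i by rewrite mem_iota eq_sym; case: i.
have prA w : prod_a L gam mu w s = \prod_(1 <= j < L.+1) (wa gam (w - mu j) * wa gam (w + mu j)).
  exact: (prod_site_labels L (fun j => wa gam (w - mu j) * wa gam (w + mu j))).
have prB w : prod_b L mu w s = \prod_(1 <= j < L.+1) (wb (w - mu j) * wb (w + mu j)).
  exact: (prod_site_labels L (fun j => wb (w - mu j) * wb (w + mu j))).
have vA w : wa gam (2 * w) != 0 -> opA _ T w *m vac L = LamA L gam mu h w *: vac L.
  by move=> a2; have [E _ _] := monodromy_vac L gam h mu s w us a2; rewrite /opA /T E prA.
have vD w : wa gam (2 * w) != 0 -> opDt gam T w *m vac L = LamDt L gam mu h w *: vac L.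
  move=> a2; have [E0 _ E1] := monodromy_vac L gam h mu s w us a2.
  rewrite [@opDt]unlock mulmxBl -scalemxAl /T E0 E1 scalerA -scalerBl /LamDt -prB.
  by congr (_ *: _); rewrite addrAC subrr add0r !mulNr.
have dA w : wa gam (2 * w) != 0 -> dual_vac L *m opA _ T w = LamAbar L gam mu h w *: dual_vac L.
  by move=> a2; have [_ _ E] := dual_vac_monodromy L gam h mu s w us a2;
    rewrite /opA /T E prA prB.
have EA u v : wb (u - v) != 0 -> wa gam (u + v) != 0 -> wa gam (2 * v) != 0 ->
  opA _ T u *m opB _ T v = coef_f gam u v *: (opB _ T v *m opA _ T u)
  + coef_g gam u v *: (opB _ T u *m opA _ T v)
    + coef_k gam u v *: (opB _ T u *m opDt gam T v).
  by move=> bn ap a2; exact: (exchange_AB gam _ T RE u v (wbB_neq0 u v bn) ap a2).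
have ED u v : wb (u - v) != 0 -> wa gam (u + v) != 0 -> wa gam (2 * u) != 0 ->
  wa gam (2 * v) != 0 ->
  opDt gam T u *m opB _ T v = coef_f' gam u v *: (opB _ T v *m opDt gam T u)
  + coef_k' gam u v *: (opB _ T u *m opA _ T v)
    + coef_g' gam u v *: (opB _ T u *m opDt gam T v).
  by move=> bn ap a2u a2v; rewrite (exchange_DB gam _ T RE tT u v bn ap a2u a2v) addrAC.
have [|i j ir jr ij|i ir|i ir||E _] := off_shell_bethe gam _ (opA _ T) (opB _ T) (opDt gam T)
  (vac L) (LamA L gam mu h) (LamDt L gam mu h) lam EA ED (opBC gam _ T RE tT) vA vD r (lam 0%N).
- exact: iota_uniq.
- by have [] := sep i j (rL i ir) (rL j jr) ij.
- exact/sep2/rL.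
- by have [] := sep 0%N i isT (rL i ir) (r0 i ir).
- exact: sep2.
have BE w : opB _ T w = mxop (Bop L gam mu h w).
  by rewrite /opB /T -blk_Tmon mxE.
have Z0 := Zpf_bethe L gam mu h (opB _ T) lam r BE.
(* An unwanted vector is again a Bethe vector, with label 0 in place of [i], so its pairing is again
   a partition function. *)
have Zi i : Zpf L gam mu h (lam 0%N :: [seq lam j | j <- r & j != i]) =
    (dual_vac L *m (opB _ T (lam 0%N) *m bethe_vector _ (opB _ T)
    (vac L) lam [seq j <- r | j != i])) 0 0.
  exact: (Zpf_bethe L gam mu h (opB _ T) lam (0%N :: [seq j <- r | j != i]) BE).
have := congr1 (fun v => (dual_vac L *m v) 0 0) E.
rewrite /= mulmxA dA ?sep2 // -scalemxAl mxZE mulmxDr -scalemxAr mxDE mxZE mulmx_sumr summxE -Z0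
  => E'.
have rE : index_iota 1 L.+1 = r by rewrite /index_iota subSS subn0.
(* [coef_g] and [coef_k] carry the minus signs, so [Mi] is the negative of the unwanted coefficient
   and the sum cancels term by term. *)
have MiE i : Mi L gam mu h lam i =
    - (coef_g gam (lam 0%N) (lam i) * weightA gam (LamA L gam mu h) lam r i +
       coef_k gam (lam 0%N) (lam i) * weightD gam (LamDt L gam mu h) lam r i).
  by rewrite /Mi rE /coef_g /coef_k /weightA /weightD /wc !mulNr -opprD opprK !mulrA.
rewrite /M0 rE mulrBl E' [_ * _ + _]addrC -!addrA addNKr -big_split big1 // => i _ /=.
by rewrite -scalemxAr mxZE -Zi MiE -mulrDl subrr mul0r.
Qed.
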